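(* Let $n\ge 5$ and let $\Gamma_p^-(n,n+1)$ be the set of all unbalanced bicyclic signed graphs on $n$ vertices with the pairing property. Let $\Gamma_1$ and $\Gamma_2$ be the following signed graphs on $n$ vertices: $\Gamma_1$ consists of one positive triangle and one negative triangle sharing exactly one common vertex $u$ (and no edge), together with $n-5$ pendant edges attached at $u$; $\Gamma_2$ consists of one positive triangle and one negative triangle sharing exactly one common edge $uv$, together with $n-4$ pendant edges attached at $u$. If $\Gamma\in\Gamma_p^-(n,n+1)\setminus\{\Gamma_1,\Gamma_2\}$ and $\Gamma$ is switching equivalent to neither $\Gamma_1$ nor $\Gamma_2$, then $EE(\Gamma_1)>EE(\Gamma_2)>EE(\Gamma)$.
   Context: Graphs are finite and simple. A signed graph $\Gamma=(G,\sigma)$ is a graph $G$ together with a function $\sigma:E(G)\to\{-1,1\}$. Its adjacency matrix $A_\Gamma$ is the symmetric matrix with $(i,j)$ entry $\sigma(ij)$ if $ij\in E(G)$ and $0$ otherwise; the eigenvalues $\mu_1,\dots,\mu_n$ of $\Gamma$ are those of $A_\Gamma$, counted with multiplicity. The Estrada index is $EE(\Gamma)=\sum_{i=1}^n e^{\mu_i}$. The sign of a cycle is the product of the signs of its edges; a signed graph is balanced if all its cycles are positive, and unbalanced otherwise. A (signed) graph is bicyclic if it is connected and its number of edges is one more than its number of vertices. A signed graph has the pairing property if $-\mu$ is an eigenvalue whenever $\mu$ is, with the same multiplicity. For $Z\subseteq V(\Gamma)$, switching with respect to $Z$ reverses the signs of all edges with exactly one endpoint in $Z$. Two signed graphs are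 called switching equivalent if one can be obtained from the other by switching, where signed graphs are considered up to isomorphism (relabelling of vertices). The signed graphs $\Gamma_1$ and $\Gamma_2$ are each determined up to switching equivalence by their description (the signs of pendant edges are irrelevant); both have $n+1$ edges. *)

(* Defs.v *)
From HB Require Import structures.
From mathcomp Require Import all_boot all_order all_fingroup all_algebra.
From mathcomp Require Import polyrcf.
From mathcomp Require Import reals sequences exp.

Set Implicit Arguments.
Unset Strict Implicit.
Unset Printing Implicit Defensive.

Import Order.TTheory GRing.Theory Num.Theory.

Local Open Scope ring_scope.

(* Edges are two-element sets of vertices. The values of [sigma] outside
   [edges] are junk. *)
Record sgraph (n : nat) := SGraph {
  edges : {set {set 'I_n}};
  sigma : {set 'I_n} -> int;
  edges_card2 : forall e, e \in edges -> #|e| = 2%N;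
  sigma_sign : forall e, e \in edges -> sigma e = 1 \/ sigma e = -1 }.

Section SignedGraphs.
Variable n : nat.
Implicit Types (G H : sgraph n) (Z : {set 'I_n}).

Definition adj G : rel 'I_n := fun x y => [set x; y] \in edges G.

Definition connected G := forall x y : 'I_n, connect (adj G) x y.

Definition bicyclic G := connected G /\ #|edges G| = n.+1.

Definition is_cycle G (c : seq 'I_n) : Prop :=
  (3 <= size c)%N /\ ucycle (adj G) c.

(* [next c x] is the cyclic successor of [x] in [c]. *)
Definition cycle_sign G (c : seq 'I_n) : int :=
  \prod_(x <- c) sigma G [set x; next c x].

Definition balanced G := forall c, is_cycle G c -> cycle_sign G c = 1.

Definition unbalanced G := ~ balanced G.

Definition switch_sigma G Z (e : {set 'I_n}) : int :=
  if #|e :&: Z| == 1%N then - sigma G e else sigma G e.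

Lemma switch_sigma_sign G Z e :
  e \in edges G -> switch_sigma G Z e = 1 \/ switch_sigma G Z e = -1.
Proof.
move=> eG; rewrite /switch_sigma; case: ifP => _; last exact: sigma_sign.
by case: (sigma_sign eG) => ->; [right | left; rewrite opprK].
Qed.

Definition switch G Z : sgraph n :=
  SGraph (@edges_card2 n G) (@switch_sigma_sign G Z).

Definition isomorphic G H := exists f : {perm 'I_n},
  edges H = [set f @: e | e : {set 'I_n} in edges G] /\
  forall e : {set 'I_n}, e \in edges G -> sigma H (f @: e) = sigma G e.

Definition switching_equivalent G H := exists Z, isomorphic (switch G Z) H.

Definition is_Gamma1 G := exists u a b c d : 'I_n,
  [/\ uniq [:: u; a; b; c; d],
      edges G = [set [set u; a]; [set a; b]; [set b; u];
                     [set u; c]; [set c; d]; [set d; u]]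
                :|: [set [set u; w] | w in ~: [set u; a; b; c; d]],
      cycle_sign G [:: u; a; b] = 1
    & cycle_sign G [:: u; c; d] = -1].

Definition is_Gamma2 G := exists u v a b : 'I_n,
  [/\ uniq [:: u; v; a; b],
      edges G = [set [set u; v]; [set v; a]; [set a; u];
                     [set v; b]; [set b; u]]
                :|: [set [set u; w] | w in ~: [set u; v; a; b]],
      cycle_sign G [:: u; v; a] = 1
    & cycle_sign G [:: u; v; b] = -1].

End SignedGraphs.

Section Spectrum.
Variables (R : realType) (n : nat).
Implicit Type G : sgraph n.

Definition adjmx G : 'M[R]_n :=
  \matrix_(i, j) if [set i; j] \in edges G then (sigma G [set i; j])%:~R else 0.

Definition eig_mult (A : 'M[R]_n) (mu : R) : nat := mup mu (char_poly A).

Definition pairing G := forall mu : R, eigenvalue (adjmx G) mu ->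
  eigenvalue (adjmx G) (- mu) /\
  eig_mult (adjmx G) (- mu) = eig_mult (adjmx G) mu.

(* [rootsR] lists the distinct real roots. As [adjmx G] is real symmetric, its
   characteristic polynomial splits over R, so these are all the eigenvalues. *)
Definition eigenvalues (A : 'M[R]_n) : seq R :=
  flatten [seq nseq (eig_mult A mu) mu | mu <- rootsR (char_poly A)].

Definition estrada G : R := \sum_(mu <- eigenvalues (adjmx G)) expR mu.

End Spectrum.

(* Main.v *)
(** Write [d(x)] for the degree of [x], and let [psi(x) = e^x + e^-x - 2 - x^2],
    whose quotient by [x^4] increases for [x >= 0]. For a graph with [n]
    vertices and [n + 1] edges, the moments of order 0, 1 and 2 of the spectrum
    are [n], [0] and [2 (n + 1)]. With a symmetric spectrum of fourth moment [2 T^4] no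
    eigenvalue exceeds [T], so the Estrada index is at most
    [2 n + 1 + psi(T)]; and if the third moment vanishes and [mu], [- mu] are
    eigenvalues, it is at least [2 n + 1 + psi(mu)], because
    [e^x >= 1 + x + x^2/2 + x^3/6]. Explicit eigenvectors of Gamma_1 and Gamma_2
    thus reduce the theorem to comparing fourth moments.

    The fourth moment is [2 sum d(x)^2 - 2 (n + 1)] plus the signed number of
    closed walks around 4-cycles. By the pairing property the triangles are
    absent or come in pairs of opposite signs. If some vertex has degree
    [n - 1], the graph is a star with two more edges, hence switching equivalent
    to Gamma_1 or Gamma_2. Otherwise pendant vertices are removed one by one
    until either a star with two more edges or a graph of minimum degree 2
    remains. In the latter all but at most two degrees equal 2, and at most one
    4-cycle is positive: a positive cycle gives a left null vector of the signed
    incidence matrix, whose left kernel is a line because the graph is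
    connected, unbalanced and bicyclic. *)

From mathcomp Require Import topology normedtype derive.
From mathcomp Require Import all_boot all_order all_fingroup all_algebra.
From mathcomp Require Import ring lra zify.
From mathcomp Require Import complex polyrcf.
From mathcomp Require Import reals sequences exp.
Require Import Defs.

Set Implicit Arguments.
Unset Strict Implicit.
Unset Printing Implicit Defensive.

Import Order.TTheory GRing.Theory Num.Theory.
Import numFieldNormedType.Exports.

Local Open Scope ring_scope.

(** * Spectra of real symmetric matrices *)

(** The margins between the fourth moments are narrow, and they shape the estimates. Half the fourth
    moment is n^2 - 2n + 9 for Gamma_2, and for the remaining graphs at most n^2 - 2n + 5 when n >=
    7. These numbers have to stay below mu^4 for an explicit eigenvalue mu of Gamma_1 and of Gamma_2
    respectively. For n = 5 and n = 6 the second bound rises by 2, to 22 and 31, against values of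
    mu^4 of about 22.4 and 30.9. Hence n = 6 narrowly escapes the comparison of single eigenvalues,
    and only there a second pair of eigenvalues of Gamma_2 is needed. Neither star has its whole
    spectrum computed: the remainder of the cubic Taylor polynomial of exp is nonnegative on the
    whole line, so a lower bound may discard any eigenvalues. Gamma_1 is only bounded from below,
    which requires no symmetry of its spectrum; Gamma_2 is also bounded from above, so the symmetry
    of its spectrum has to be proved. *)

Lemma char_poly_conj (F : fieldType) n (P A B : 'M[F]_n) :
  P \in unitmx -> P *m A = B *m P -> char_poly A = char_poly B.
Proof.
move=> Punit PA; rewrite /char_poly.
have P'unit : \det (map_mx (@polyC F) P) != 0.
  by rewrite det_map_mx polyC_eq0 -unitfE -unitmxE.
apply: (mulfI P'unit); rewrite -det_mulmx mulrC -det_mulmx.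
congr (\det _); rewrite /char_poly_mx mulmxBr mulmxBl -!map_mxM /= PA.
by rewrite scalar_mxC.
Qed.

(** Over R[i] the matrix is hermitian, hence unitarily diagonalisable with real diagonal, and the
    real parts of the diagonal serve as spectrum. The factor [c] is used with the values 1 and -1,
    the latter for the spectrum of [- A]. *)
Lemma symmetric_spectrum (R : rcfType) n (A : 'M[R]_n) : A^T = A ->
  exists rs : seq R,
  [/\ size rs = n,
      forall c, char_poly (c *: A) = \prod_(r <- rs) ('X - (c * r)%:P)
    & forall k, \tr (iter k (mulmx A) 1%:M) = \sum_(r <- rs) r ^+ k].
Proof.
move=> Asym.
pose toC : {rmorphism R -> R[i]} := real_complex R.
pose AC := map_mx toC A.
have ACsym : AC \is symmetricmx.
  apply/is_hermitianmxP; rewrite expr0 scale1r.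
  by apply/matrixP=> i j; rewrite !mxE /= -[in RHS]Asym mxE.
have ACreal : AC \is a mxOver Num.real.
  by apply/mxOverP=> i j; rewrite mxE complex_real.
have /orthomx_spectralP := symmetric_normalmx ACsym ACreal.
have := hermitian_spectral_diag_real (realsym_hermsym ACsym ACreal).
have Punit := spectral_unit AC.
move: (spectralmx AC) (spectral_diag AC) Punit => P D Punit /mxOverP Dreal ACE.
pose r i := complex.Re (D 0 i).
have Dr i : D 0 i = toC (r i) by symmetry; apply: RRe_real.
have PAC : P *m AC = diag_mx D *m P by rewrite ACE !mulmxA mulmxV // mul1mx.
exists [seq r i | i <- enum 'I_n]; split.
- by rewrite size_map size_enum_ord.
- move=> c; apply: (map_poly_inj toC); rewrite map_char_poly map_mxZ.
  have PcA : P *m (toC c *: AC) = (toC c *: diag_mx D) *m P.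
    by rewrite -scalemxAr PAC scalemxAl.
  rewrite (char_poly_conj Punit PcA) char_poly_trig.
    rewrite rmorph_prod /= big_map big_enum /=; apply: eq_bigr => i _.
    by rewrite rmorphB /= map_polyX map_polyC /= !mxE eqxx Dr -rmorphM.
  by apply/is_trig_mxP => i j ij; rewrite !mxE -val_eqE /= (ltn_eqF ij) mulr0.
- move=> k; apply: (@complexI R); rewrite -/toC -[LHS]trace_map_mx.
  have -> : map_mx toC (iter k (mulmx A) 1%:M) = iter k (mulmx AC) 1%:M.
    by elim: k => [|k IH] /=; rewrite ?map_mx1 // map_mxM IH.
  have PACk : P *m iter k (mulmx AC) 1%:M = diag_mx (\row_i D 0 i ^+ k) *m P.
    elim: k => [|k IH] /=.
      rewrite mulmx1 (_ : diag_mx _ = 1%:M) ?mul1mx //.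
      by apply/matrixP=> i j; rewrite !mxE expr0.
    rewrite mulmxA PAC -mulmxA IH mulmxA; congr (_ *m P).
    apply/matrixP=> i j; rewrite mul_diag_mx !mxE exprS.
    by case: eqP => [->|]; rewrite ?mulr0.
  have -> : iter k (mulmx AC) 1%:M
      = invmx P *m (diag_mx (\row_i D 0 i ^+ k) *m P).
    by rewrite -PACk mulKmx.
  rewrite mxtrace_mulC -mulmxA mulmxV // mulmx1 mxtrace_diag.
  rewrite rmorph_sum big_map big_enum /=; apply: eq_bigr => i _.
  by rewrite mxE Dr rmorphXn.
Qed.

Lemma perm_eigenvalues (R : realType) n (A : 'M[R]_n) (rs : seq R) :
  char_poly A = \prod_(r <- rs) ('X - r%:P) -> perm_eq (eigenvalues A) rs.
Proof.
move=> cpA; have cp0 : char_poly A != 0 by rewrite monic_neq0 ?char_poly_monic.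
have mult mu : eig_mult A mu = count_mem mu rs.
  by rewrite /eig_mult cpA mu_prod_XsubC.
apply/allP => x _ /=; apply/eqP; rewrite /eigenvalues count_flatten -map_comp.
rewrite sumnE big_map.
under eq_bigr => mu _ do rewrite /= count_nseq /= mult.
have [xr|xr] := boolP (x \in rootsR (char_poly A)).
  rewrite (bigD1_seq x) //= ?uniq_roots // eqxx mul1n big1 ?addn0 //.
  by move=> mu /negPf ->.
rewrite big_seq big1 => [|mu mur]; last first.
  by rewrite (_ : (mu == x) = false) //; apply: contraNF xr => /eqP <-.
symmetry; apply/count_memPn; apply: contra xr => xrs.
have := roots_on_rootsR cp0 x; rewrite in_itv /= => <-.
by rewrite cpA root_prod_XsubC.
Qed.

(** * Bounds for the exponential function *)

Section ExpBounds.
Local Open Scope classical_set_scope.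
Local Open Scope ring_scope.
Variable R : realType.
Implicit Types x y : R.

Definition cosh_tail x : R := expR x + expR (- x) - 2 - x ^+ 2.

(** Adding the series at [x] and [- x] cancels the odd powers; the first four terms sum to
    [2 + x ^+ 2], exactly what [cosh_tail] subtracts. *)
Let partial x N := series (exp_coeff x) N + series (exp_coeff (- x)) N.

Let partial_recr x N :
  partial x N.+1 = partial x N + (x ^+ N + (- x) ^+ N) / N`!%:R.
Proof.
by rewrite /partial /series /= !big_nat_recr //= /exp_coeff /= mulrDl addrACA.
Qed.

Let partial4 x : partial x 4 = 2 + x ^+ 2.
Proof.
rewrite !partial_recr /partial /series /= !big_geq // -[3`!]/6%N -[2`!]/2%N.
by rewrite !fact0 expr0 expr1 -[1`!]/1%N; field.
Qed.

Let partial_cvg x : (partial x @ \oo) --> (expR x + expR (- x)).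
Proof. by apply: cvgD; apply: is_cvg_series_exp_coeff. Qed.

(* Every power of x in the expansion of cosh_tail is at least the fourth. *)
Lemma cosh_tail_quartic x y : `|x| <= y ->
  y ^+ 4 * cosh_tail x <= x ^+ 4 * cosh_tail y.
Proof.
move=> xy; have y0 : 0 <= y := le_trans (normr_ge0 x) xy.
have step k : y ^+ 4 * (x ^+ (k + 4) + (- x) ^+ (k + 4))
    <= x ^+ 4 * (y ^+ (k + 4) + (- y) ^+ (k + 4)).
  rewrite (exprNn x) (exprNn y) -signr_odd oddD addbF.
  have [ek|ek] := boolP (odd k); first by rewrite expr1 !mulN1r !subrr !mulr0.
  have xk : x ^+ k <= y ^+ k.
    apply: le_trans (ler_norm _) _; rewrite normrX.
    by apply: lerXn2r; rewrite ?nnegrE.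
  rewrite expr0 !mul1r !exprD.
  have xy4 : 0 <= x ^+ 4 * y ^+ 4 by rewrite mulr_ge0 ?exprn_even_ge0.
  have := ler_wpM2l xy4 xk; lra.
have fin N : y ^+ 4 * (partial x (N + 4) - 2 - x ^+ 2)
    <= x ^+ 4 * (partial y (N + 4) - 2 - y ^+ 2).
  elim: N => [|N IH]; first by rewrite add0n !partial4; lra.
  have f0 : 0 <= ((N + 4)`!%:R : R)^-1 by rewrite invr_ge0.
  by rewrite addSn !partial_recr; have := ler_wpM2r f0 (step N); lra.
have lims z w : ((fun N => w * (partial z (N + 4) - 2 - z ^+ 2)) @ \oo)
    --> w * cosh_tail z.
  apply: cvgM; first exact: cvg_cst.
  apply: cvgB; last exact: cvg_cst.
  apply: cvgB; last exact: cvg_cst.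
  by have := @partial_cvg z; rewrite -(cvg_shiftn 4).
apply: (ler_cvg_to (lims x (y ^+ 4)) (lims y (x ^+ 4))).
by apply: nearW => N; apply: fin.
Qed.

(** The left side is the leading term 2 x^4 / 4! of the series, and the later terms are
    nonnegative. *)
Lemma cosh_tail_ge x : x ^+ 4 / 12 <= cosh_tail x.
Proof.
have fin N : x ^+ 4 / 12 <= partial x (N + 5) - 2 - x ^+ 2.
  elim: N => [|N IH].
    have -> : partial x 5 = 2 + x ^+ 2 + x ^+ 4 / 12.
      by rewrite partial_recr partial4 -[4`!]/24%N; field.
    lra.
  rewrite addSn partial_recr; apply: le_trans IH _.
  rewrite -subr_ge0 (_ : _ - _ = (x ^+ (N + 5) + (- x) ^+ (N + 5)) / (N + 5)`!%:R);
    last by ring.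
  apply: mulr_ge0; last by rewrite invr_ge0.
  rewrite exprNn -signr_odd oddD addbT.
  have [eN|eN] := boolP (odd N); last by rewrite expr1 mulN1r subrr.
  by rewrite expr0 mul1r addr_ge0 // exprn_even_ge0 // oddD eN.
have lims : ((fun N => partial x (N + 5) - 2 - x ^+ 2) @ \oo)
    --> cosh_tail x.
  apply: cvgB; last exact: cvg_cst.
  apply: cvgB; last exact: cvg_cst.
  by have := @partial_cvg x; rewrite -(cvg_shiftn 5).
apply: (ler_cvg_to (cvg_cst _) lims).
by apply: nearW => N; apply: fin.
Qed.

Lemma cosh_tail_ge0 x : 0 <= cosh_tail x.
Proof. by have := cosh_tail_ge x; have := @exprn_even_ge0 _ 4 x isT; lra. Qed.

Lemma cosh_tail_gt0 x : x != 0 -> 0 < cosh_tail x.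
Proof.
move=> x0; apply: lt_le_trans (cosh_tail_ge x).
by rewrite divr_gt0 // exprn_even_gt0.
Qed.

Lemma cosh_tail_lt x y : 0 <= x < y -> cosh_tail x < cosh_tail y.
Proof.
move=> /andP[x0 xy]; have y0 := le_lt_trans x0 xy.
have q := @cosh_tail_quartic x y; rewrite ger0_norm // ltW // in q.
have py : 0 < cosh_tail y by rewrite cosh_tail_gt0 // gt_eqF.
have x4 : x ^+ 4 < y ^+ 4 by rewrite ltrXn2r.
have y4 : 0 < y ^+ 4 by rewrite exprn_gt0.
rewrite -(ltr_pM2l y4); apply: le_lt_trans (q isT) _.
by rewrite ltr_pM2r.
Qed.

(** The Taylor polynomial has odd degree, so the remainder has the sign of x^4. For [x >= 0] it is a
    sum of nonnegative series terms; for [x < 0] the mean value theorem replaces the series. *)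
Lemma expR_ge_cubic x : 1 + x + x ^+ 2 / 2 + x ^+ 3 / 6 <= expR x.
Proof.
have [x0|x0] := leP 0 x.
  have fin N : 1 + x + x ^+ 2 / 2 + x ^+ 3 / 6 <= series (exp_coeff x) (N + 4)%N.
    elim: N => [|N IH].
      rewrite /series /= !big_nat_recr //= big_geq // /exp_coeff /=.
      by rewrite -[3`!]/6%N -[2`!]/2%N fact0 expr0 expr1 -[1`!]/1%N; lra.
    rewrite addSn /series /= big_nat_recr //=; apply: le_trans IH _.
    by rewrite lerDl exp_coeff_ge0.
  have := is_cvg_series_exp_coeff x; rewrite -(cvg_shiftn 4) => lims.
  apply: (ler_cvg_to (cvg_cst _) lims).
  by apply: nearW => N; apply: fin.
(* On the negative side, exp(y) (1 - y + y^2/2 - y^3/6) has derivative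
   -exp(y) y^3/6 and equals 1 at 0. *)
pose p : {poly R} := 1 - 'X + (1/2)%:P * 'X^2 - (1/6)%:P * 'X^3.
pose f z := expR z * p.[z].
pose y := - x; have y0 : 0 < y by rewrite oppr_gt0.
have df (z : R) : is_derive z (1 : R) f (expR z * (p + p^`()).[z]).
  apply: is_derive_eq (is_deriveM (is_derive_expR z) (is_derive_poly p z)) _.
  by rewrite hornerD mulrDr addrC /GRing.scale /= [p.[z] * _]mulrC.
pose o : R := 0.
have [] := @MVT R f _ o y y0 (fun z _ => df z).
  apply: continuous_subspaceT => z.
  by apply/differentiable_continuous/derivable1_diffP; apply: ex_derive.
move=> c; rewrite in_itv /= => /andP[c0 cy].
have -> : (p + p^`()).[c] = - (c ^+ 3 / 6).
  rewrite /p !(derivB, derivD, derivM, derivC, derivX, derivXn) !hornerE /=.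
  rewrite !hornerE /=.
  by field.
have p0 : p.[0] = 1 by rewrite /p !hornerE /=; ring.
have py : p.[y] = 1 + x + x ^+ 2 / 2 + x ^+ 3 / 6.
  by rewrite /p !hornerE /y /=; field.
rewrite /f /o expR0 p0 py.
have : 0 <= expR c * (c ^+ 3 / 6) * (y - 0).
  by rewrite subr0 ltW // !mulr_gt0 ?expR_gt0 // ?exprn_gt0 // invr_gt0.
move=> h /eqP; rewrite mulr1 mulrN mulNr subr_eq => /eqP eqf.
have {h eqf}: expR y * (1 + x + x ^+ 2 / 2 + x ^+ 3 / 6) <= 1.
  by rewrite eqf addrC gerBl.
by rewrite /y expRN mulrC ler_pdivrMr ?expR_gt0 // mul1r.
Qed.
End ExpBounds.

(** * Degrees, triangles and 4-cycles in signed graphs *)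

Lemma Posz_sum (I : Type) (r : seq I) (P : pred I) (F : I -> nat) :
  (\sum_(i <- r | P i) F i)%N%:Z = \sum_(i <- r | P i) (F i)%:Z.
Proof. by rewrite -natz natr_sum; apply: eq_bigr => i _; rewrite natz. Qed.

Lemma uniq_size_le_card (T : finType) (s : seq T) (A : {set T}) :
  uniq s -> {subset s <= A} -> (size s <= #|A|)%N.
Proof.
by move=> us sA; rewrite cardE; apply: uniq_leq_size => // x /sA; rewrite mem_enum.
Qed.

Section SignedAdjacency.
Variables (V : finType) (a : V -> V -> int).
Hypothesis a_sym : forall x y, a x y = a y x.
Hypothesis a_irr : forall x, a x x = 0.
Hypothesis a_sqr : forall x y, a x y ^+ 2 = (a x y != 0)%:R.
Implicit Types (S R X : {set V}) (u v w x y z : V).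

(** All counts are relative to a vertex set [S], so that vertices can be removed without changing
    the type of vertices. *)
Definition deg S x : nat := #|[set y in S | a x y != 0]|.

Definition arcs S : {set V * V} :=
  [set p | [&& p.1 \in S, p.2 \in S & a p.1 p.2 != 0]].

(** The sums run over ordered tuples: a triangle contributes its sign six times here, and a 4-cycle
    contributes its sign eight times to [quad] below. *)
Definition tri S : int :=
  \sum_(i in S) \sum_(j in S) \sum_(k in S) a i j * a j k * a k i.

(* The 4-cycle i-k-j-l: i, j and k, l are the pairs of opposite corners. *)
Definition quad_term i j k l : int :=
  if (i != j) && (k != l) then a i k * a k j * a j l * a l i else 0.

Definition quad S : int :=
  \sum_(i in S) \sum_(j in S) \sum_(k in S) \sum_(l in S) quad_term i j k l.

Lemma arcsE S x y :
  ((x, y) \in arcs S) = [&& x \in S, y \in S & a x y != 0].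
Proof. by rewrite inE. Qed.

Lemma degE S x : (deg S x)%:Z = \sum_(y in S) a x y ^+ 2.
Proof.
rewrite /deg -sum1_card Posz_sum big_mkcond [RHS]big_mkcond /=.
by apply: eq_bigr => y _; rewrite inE a_sqr; case: (y \in S); case: eqP.
Qed.

Lemma sum_setD1 S x (F : V -> int) : x \in S ->
  \sum_(y in S) F y = F x + \sum_(y in S :\ x) F y.
Proof. exact: big_setD1. Qed.

Lemma deg_setD1 S x y : x \in S -> deg S y = (deg (S :\ x) y + (a y x != 0))%N.
Proof.
move=> xS; apply/eqP; rewrite -eqz_nat PoszD !degE.
by rewrite (sum_setD1 _ xS) addrC a_sqr natz.
Qed.

Lemma sum_deg_setD1 S x : x \in S ->
  (\sum_(y in S) deg S y = \sum_(y in S :\ x) deg (S :\ x) y + 2 * deg S x)%N.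
Proof.
move=> xS; have key : (\sum_(y in S :\ x) (a y x != 0) = deg S x)%N.
  apply/eqP; rewrite -eqz_nat degE (sum_setD1 _ xS) a_irr expr0n /= add0r Posz_sum.
  by apply/eqP/eq_bigr => y _; rewrite a_sqr a_sym natz.
rewrite (big_setD1 x xS) (eq_bigr _ (fun y _ => deg_setD1 y xS)).
by rewrite big_split /= key; lia.
Qed.

Lemma card_arcs S : #|arcs S| = (\sum_(x in S) deg S x)%N.
Proof.
rewrite -sum1_card (eq_bigl (fun p : V * V => (p.1 \in S) &&
  ((p.2 \in S) && (a p.1 p.2 != 0)))); last by move=> p; rewrite inE.
rewrite -(pair_big_dep _ (fun x y => (y \in S) && (a x y != 0)) (fun _ _ => 1%N)).
apply: eq_bigr => x _; rewrite sum1_card; apply: eq_card => y.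
by rewrite !inE.
Qed.

Lemma tri_setD1 S u : u \in S ->
  tri S = tri (S :\ u)
    + 3 * \sum_(j in S :\ u) \sum_(k in S :\ u) a u j * a j k * a k u.
Proof.
move=> uS; set R := S :\ u; rewrite /tri (sum_setD1 _ uS) -/R.
have inner i j : \sum_(k in S) a i j * a j k * a k i
    = a i j * a j u * a u i + \sum_(k in R) a i j * a j k * a k i.
  by rewrite (sum_setD1 _ uS).
have -> : \sum_(j in S) \sum_(k in S) a u j * a j k * a k u
    = \sum_(j in R) \sum_(k in R) a u j * a j k * a k u.
  rewrite (sum_setD1 _ uS) big1 ?add0r => [|k _]; last by rewrite a_irr !mul0r.
  by apply: eq_bigr => j _; rewrite inner a_irr mulr0 add0r.
have -> : \sum_(i in R) \sum_(j in S) \sum_(k in S) a i j * a j k * a k i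
    = \sum_(i in R) \sum_(k in R) a i u * a u k * a k i
    + (\sum_(i in R) \sum_(j in R) a i j * a j u * a u i
       + \sum_(i in R) \sum_(j in R) \sum_(k in R) a i j * a j k * a k i).
  rewrite -!big_split; apply: eq_bigr => i _ /=.
  rewrite (sum_setD1 _ uS) inner a_irr mulr0 mul0r add0r; congr (_ + _).
  by rewrite -big_split; apply: eq_bigr => j _; rewrite inner.
have -> : \sum_(i in R) \sum_(k in R) a i u * a u k * a k i
    = \sum_(j in R) \sum_(k in R) a u j * a j k * a k u.
  by rewrite exchange_big; do 2!apply: eq_bigr => ? _; ring.
have -> : \sum_(i in R) \sum_(j in R) a i j * a j u * a u i
    = \sum_(j in R) \sum_(k in R) a u j * a j k * a k u.
  by do 2!apply: eq_bigr => ? _; ring.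
by ring.
Qed.

(** The vertex [u] can be any of the four corners, whence the factor 4. With [u] and the opposite
    corner [j] fixed, ordered pairs of distinct middle vertices are the square of a sum minus its
    diagonal. *)
Lemma quad_setD1 S u : u \in S ->
  quad S = quad (S :\ u)
    + 4 * \sum_(j in S :\ u) ((\sum_(k in S :\ u) a u k * a k j) ^+ 2
                              - \sum_(k in S :\ u) (a u k * a k j) ^+ 2).
Proof.
move=> uS; set R := S :\ u.
have Ru x : x \in R -> (u != x) = true.
  by rewrite !inE eq_sym => /andP[].
have Ru' x : x \in R -> (x != u) = true.
  by rewrite !inE => /andP[].
have t2 i j k : quad_term i j k k = 0 by rewrite /quad_term eqxx andbF.
set Q := \sum_(j in R) _.
have QE : Q = \sum_(j in R) \sum_(k in R) \sum_(l in R) quad_term u j k l.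
  apply: eq_bigr => j jR; rewrite expr2 big_distrl /= -sumrB.
  apply: eq_bigr => k kR; rewrite big_distrr /= (bigD1 k) //=.
  rewrite [in RHS](bigD1 k) //= t2 add0r.
  rewrite addrAC expr2 subrr add0r; apply: eq_bigr => l /andP[lR lk].
  by rewrite /quad_term Ru // eq_sym lk /= [a l j]a_sym [a u l]a_sym; ring.
have t1 i j k : quad_term i i k j = 0 by rewrite /quad_term eqxx.
have t3 i j l : quad_term i j i l = 0.
  by rewrite /quad_term a_irr !mul0r; case: ifP.
have t4 i j k : quad_term i j k i = 0.
  by rewrite /quad_term a_irr mulr0; case: ifP.
have t5 i j l : quad_term i j j l = 0.
  by rewrite /quad_term a_irr !(mulr0, mul0r); case: ifP.
have t6 i j l : quad_term i j l j = 0.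
  by rewrite /quad_term a_irr !(mulr0, mul0r); case: ifP.
(* The symmetries [swap] and [rot] of the 4-cycle carry [u] from any corner to the first one; [t1]
   to [t6] discard the tuples in which [u] occurs twice. *)
have swap i j k l : quad_term i j k l = quad_term j i l k.
  rewrite /quad_term eq_sym [k == l]eq_sym.
  by case: ifP => // _; ring.
have rot i j k l : quad_term i j k l = quad_term k l j i.
  by rewrite /quad_term andbC [i == j]eq_sym; case: ifP => // _; ring.
pose F i j := \sum_(k in S) \sum_(l in S) quad_term i j k l.
have FE i j : F i j = \sum_(l in R) quad_term i j u l
    + (\sum_(k in R) quad_term i j k u
       + \sum_(k in R) \sum_(l in R) quad_term i j k l).
  rewrite /F (sum_setD1 _ uS) (sum_setD1 _ uS) t2 add0r; congr (_ + _).
  by rewrite -big_split; apply: eq_bigr => k _; rewrite (sum_setD1 _ uS).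
have FuR j : F u j = \sum_(k in R) \sum_(l in R) quad_term u j k l.
  rewrite FE big1 => [|l _]; last exact: t3.
  by rewrite big1 => [|k _]; [rewrite !add0r | exact: t4].
have FRu i : F i u = \sum_(k in R) \sum_(l in R) quad_term i u k l.
  rewrite FE big1 => [|l _]; last exact: t5.
  by rewrite big1 => [|k _]; [rewrite !add0r | exact: t6].
have -> : quad S = Q + (\sum_(i in R) F i u
    + \sum_(i in R) \sum_(j in R) F i j).
  rewrite /quad -/F (sum_setD1 _ uS) (sum_setD1 _ uS) -/(F u u) FuR.
  rewrite big1 ?add0r => [|k _]; last by rewrite big1.
  congr (_ + _); first by rewrite QE; apply: eq_bigr => j _; rewrite -FuR.
  by rewrite -big_split; apply: eq_bigr => i _; rewrite (sum_setD1 _ uS).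
have -> : \sum_(i in R) F i u = Q.
  rewrite QE; apply: eq_bigr => i _; rewrite FRu exchange_big.
  by do 2!apply: eq_bigr => ? _; rewrite swap.
have -> : \sum_(i in R) \sum_(j in R) F i j
    = \sum_(i in R) \sum_(j in R) \sum_(l in R) quad_term i j u l
    + (\sum_(i in R) \sum_(j in R) \sum_(k in R) quad_term i j k u + quad R).
  rewrite -!big_split; apply: eq_bigr => i _ /=.
  by rewrite -!big_split; apply: eq_bigr => j _; rewrite FE.
have -> : \sum_(i in R) \sum_(j in R) \sum_(l in R) quad_term i j u l = Q.
  rewrite QE; under eq_bigr => i _ do rewrite exchange_big /=.
  rewrite exchange_big; apply: eq_bigr => l _ /=; rewrite exchange_big.
  by do 2!apply: eq_bigr => ? _; rewrite rot.
have -> : \sum_(i in R) \sum_(j in R) \sum_(k in R) quad_term i j k u = Q.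
  rewrite QE; under eq_bigr => i _ do rewrite exchange_big /=.
  rewrite exchange_big; apply: eq_bigr => l _ /=.
  by do 2!apply: eq_bigr => ? _; rewrite swap rot.
by ring.
Qed.

Lemma adj_neq x y : a x y != 0 -> x != y.
Proof. by apply: contraNneq => ->; rewrite a_irr. Qed.

Lemma adjC x y : (a x y != 0) = (a y x != 0).
Proof. by rewrite a_sym. Qed.

Lemma tri_eq0 S :
  (forall i j k, i \in S -> j \in S -> k \in S ->
     a i j != 0 -> a j k != 0 -> a k i != 0 -> False) -> tri S = 0.
Proof.
move=> no_tri; rewrite /tri big1 // => i iS; rewrite big1 // => j jS.
rewrite big1 // => k kS; apply/eqP; rewrite !mulf_eq0 -!orbA.
apply/negPn/negP; rewrite !negb_or => /and3P[ij jk ki].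
exact: (no_tri i j k).
Qed.

Lemma quad_eq0 S :
  (forall i j k l, i \in S -> j \in S -> k \in S -> l \in S ->
     i != j -> k != l ->
     a i k != 0 -> a k j != 0 -> a j l != 0 -> a l i != 0 -> False) ->
  quad S = 0.
Proof.
move=> no_quad; rewrite /quad big1 // => i iS; rewrite big1 // => j jS.
rewrite big1 // => k kS; rewrite big1 // => l lS; rewrite /quad_term.
case: ifP => // /andP[ij kl]; apply/eqP; rewrite !mulf_eq0 -!orbA.
apply/negPn/negP; rewrite !negb_or => /and4P[ik kj jl li].
exact: (no_quad i j k l).
Qed.

(** A triangle has six arcs and a 4-cycle eight; exhibiting five distinct ones is enough. *)
Lemma few_arcs S : (#|arcs S| <= 4)%N -> tri S = 0 /\ quad S = 0.
Proof.
move=> le4; split.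
  apply: tri_eq0 => i j k iS jS kS ij jk ki.
  suff: (5 <= #|arcs S|)%N by lia.
  apply: (@uniq_size_le_card _ [:: (i, j); (j, i); (j, k); (k, j); (k, i)]).
    have [nij njk nki] := And3 (adj_neq ij) (adj_neq jk) (adj_neq ki).
    have [nji nkj nik] := And3 nij njk nki; rewrite eq_sym in nji.
    rewrite eq_sym in nkj; rewrite eq_sym in nik; rewrite /= !inE !xpair_eqE.
    by do !rewrite ?(negPf nij, negPf njk, negPf nki, negPf nji, negPf nkj,
      negPf nik, andbF, andFb).
  apply/allP => /=; rewrite !inE /= iS jS kS /= ij jk ki.
  by rewrite (adjC j i) ij (adjC k j) jk.
apply: quad_eq0 => i j k l iS jS kS lS ij kl ik kj jl li.
suff: (5 <= #|arcs S|)%N by lia.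
apply: (@uniq_size_le_card _ [:: (i, k); (k, i); (k, j); (j, k); (j, l)]).
  have [nik nkj njl] := And3 (adj_neq ik) (adj_neq kj) (adj_neq jl).
  have [nki njk] := conj nik nkj; rewrite eq_sym in nki; rewrite eq_sym in njk.
  have [nji nlk] := conj ij kl; rewrite eq_sym in nji; rewrite eq_sym in nlk.
  rewrite /= !inE !xpair_eqE.
  by do !rewrite ?(negPf nik, negPf nkj, negPf njl, negPf nki, negPf njk,
    negPf nji, negPf ij, negPf nlk, negPf kl, andbF, andFb).
apply/allP => /=; rewrite !inE /= iS jS kS lS /= ik kj jl.
by rewrite (adjC k i) ik (adjC j k) kj.
Qed.

Lemma degP S x y : y \in S -> a x y != 0 -> (0 < deg S x)%N.
Proof. by move=> yS xy; apply/card_gt0P; exists y; rewrite inE yS. Qed.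

(** * Removal of a pendant vertex *)

Section Leaf.
Variables (S : {set V}) (w : V).
Hypothesis wS : w \in S.
Hypothesis deg_w : deg S w = 1%N.

Lemma leaf_neighbour : exists x, [/\ x \in S :\ w, a w x != 0
  & forall y, y \in S -> a w y != 0 -> y = x].
Proof.
move/eqP/cards1P: deg_w => [x nbE]; exists x.
have : x \in [set x] by rewrite inE.
rewrite -nbE inE => /andP[xS wx]; split => //.
  by rewrite !inE xS andbT eq_sym adj_neq.
by move=> y yS wy; apply/set1P; rewrite -nbE inE yS.
Qed.

Lemma tri_leaf : tri S = tri (S :\ w).
Proof.
have [x [xR wx nbx]] := leaf_neighbour.
rewrite (tri_setD1 wS) big1 ?mulr0 ?addr0 // => j; rewrite inE => /andP[_ jS].
rewrite big1 // => k; rewrite inE => /andP[_ kS].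
have [wj|] := eqVneq (a w j) 0; first by rewrite wj !mul0r.
move=> /(nbx _ jS) ->; rewrite [a k w]a_sym.
have [wk|] := eqVneq (a w k) 0; first by rewrite wk mulr0.
by move=> /(nbx _ kS) ->; rewrite a_irr mulr0 mul0r.
Qed.

Lemma quad_leaf : quad S = quad (S :\ w).
Proof.
have [x [xR wx nbx]] := leaf_neighbour.
rewrite (quad_setD1 wS) big1 ?mulr0 ?addr0 // => j _.
have nbx0 k : k \in (S :\ w) :\ x -> a w k = 0.
  rewrite !inE => /and3P[kx _ kS]; apply/eqP.
  by apply: contraNT kx => /(nbx _ kS)/eqP.
rewrite !(sum_setD1 _ xR) !big1 ?addr0 ?subrr // => k /nbx0 ->.
  by rewrite mul0r expr0n.
by rewrite mul0r.
Qed.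

Lemma sum_deg_sqr_leaf x : x \in S :\ w -> a w x != 0 ->
  (\sum_(y in S) deg S y ^ 2
   = \sum_(y in S :\ w) deg (S :\ w) y ^ 2 + 2 * deg (S :\ w) x + 2)%N.
Proof.
move=> xR wx; have [x' [_ _ nbx]] := leaf_neighbour.
have xS : x \in S by move: xR; rewrite inE => /andP[].
have xx' := nbx _ xS wx; subst x'.
rewrite (big_setD1 w wS) /= deg_w (big_setD1 x xR) [in RHS](big_setD1 x xR) /=.
rewrite (deg_setD1 x wS) (adjC x w) wx.
rewrite (eq_bigr (fun y => deg (S :\ w) y ^ 2)%N) => [|y]; first by lia.
rewrite !inE => /and3P[yx _ yS]; rewrite (deg_setD1 y wS) (adjC y w).
have -> : (a w y != 0) = false by apply: contraNF yx => /(nbx _ yS)/eqP.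
by rewrite addn0.
Qed.

End Leaf.

(** Connectedness in terms of cuts avoids paths inside [S] and is easily passed to [S] minus a
    pendant vertex. *)
Definition cut_connected S := forall X, X \subset S -> X != set0 -> X != S ->
  exists x y, [/\ x \in X, y \in S, y \notin X & a x y != 0].

(** If the neighbour of [w] lies in [X], the cut [w |: X] is used instead of [X]; in either case the
    crossing edge avoids [w]. *)
Lemma cut_connected_leaf S w : w \in S -> deg S w = 1%N ->
  cut_connected S -> cut_connected (S :\ w).
Proof.
move=> wS dw cS X XR X0 XnR.
have [x [xR wx nbx]] := leaf_neighbour dw.
have XS : X \subset S by apply: subset_trans XR (subsetDl _ _).
have wX : w \notin X by apply/negP => /(subsetP XR); rewrite !inE eqxx.
have [xX|xX] := boolP (x \in X).
  have [|||y [z [yX zS zX yz]]] := cS (w |: X).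
  - by rewrite subUset sub1set wS XS.
  - by apply/set0Pn; exists w; rewrite !inE eqxx.
  - by apply: contraNneq XnR => <-; rewrite setU1K.
  move: zX; rewrite !inE negb_or => /andP[zw zX]; exists y, z; split => //.
    case/setU1P: yX => // yw; rewrite yw in yz.
    by move: zX; rewrite (nbx _ zS yz) xX.
  by rewrite !inE zw.
have [|||y [z [yX zS zX yz]]] := cS X => //.
  by apply: contraNneq wX => ->.
exists y, z; split => //; rewrite !inE zS andbT.
apply: contraNneq xX => zw; rewrite -(nbx y) //; first exact: (subsetP XS).
by rewrite adjC -zw.
Qed.

(** For [S] the whole vertex set, the left side is the trace of A^4. In a closed walk i-k-j-l either
    i = j, or k = l, or the walk is a 4-cycle. Each coincidence alone yields the sum of squared
    degrees, and both together yield the sum of degrees, which inclusion-exclusion subtracts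
    once. *)
Lemma sum_walk2_sqr S :
  \sum_(i in S) \sum_(j in S) (\sum_(k in S) a i k * a k j) ^+ 2
  = 2 * (\sum_(x in S) deg S x ^ 2)%N%:Z - (\sum_(x in S) deg S x)%N%:Z + quad S.
Proof.
pose t i j k l := a i k * a k j * a j l * a l i.
have delta (F : V -> int) x : x \in S ->
    \sum_(j in S) (x == j)%:R * F j = F x.
  move=> xS; rewrite (sum_setD1 _ xS) eqxx mul1r big1 ?addr0 // => j.
  by rewrite !inE eq_sym => /andP[/negPf -> _]; rewrite mul0r.
have tE i j k l : t i j k l = quad_term i j k l + (i == j)%:R * t i j k l
    + (k == l)%:R * t i j k l - (i == j)%:R * ((k == l)%:R * t i j k l).
  by rewrite /quad_term -/(t i j k l); case: eqP; case: eqP => /= _ _; ring.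
have degsq x : (deg S x ^ 2)%N%:Z = (\sum_(y in S) a x y ^+ 2) ^+ 2.
  by rewrite -degE PoszM expr2.
have -> : \sum_(i in S) \sum_(j in S) (\sum_(k in S) a i k * a k j) ^+ 2
    = \sum_(i in S) \sum_(j in S) \sum_(k in S) \sum_(l in S) t i j k l.
  apply: eq_bigr => i _; apply: eq_bigr => j _; rewrite expr2 big_distrl /=.
  apply: eq_bigr => k _; rewrite big_distrr /=; apply: eq_bigr => l _.
  by rewrite /t [a l j]a_sym [a i l]a_sym; ring.
pose s4 (F : V -> V -> V -> V -> int) :=
  \sum_(i in S) \sum_(j in S) \sum_(k in S) \sum_(l in S) F i j k l.
have s4D F G : s4 (fun i j k l => F i j k l + G i j k l) = s4 F + s4 G.
  rewrite /s4 -big_split; apply: eq_bigr => i _; rewrite -big_split.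
  apply: eq_bigr => j _; rewrite -big_split; apply: eq_bigr => k _.
  by rewrite -big_split.
have s4B F G : s4 (fun i j k l => F i j k l - G i j k l) = s4 F - s4 G.
  rewrite /s4 -sumrB; apply: eq_bigr => i _; rewrite -sumrB.
  apply: eq_bigr => j _; rewrite -sumrB; apply: eq_bigr => k _.
  by rewrite -sumrB.
rewrite -/(s4 t) (_ : s4 t = quad S
    + s4 (fun i j k l => (i == j)%:R * t i j k l)
    + s4 (fun i j k l => (k == l)%:R * t i j k l)
    - s4 (fun i j k l => (i == j)%:R * ((k == l)%:R * t i j k l))); last first.
  rewrite -[quad S]/(s4 _) -!s4D -s4B; do 4!apply: eq_bigr => ? _; exact: tE.
set X1 := (X in _ + X + _ - _); set X2 := (X in _ + _ + X - _).
set X3 := (X in _ + _ + _ - X).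
have -> : X1 = (\sum_(x in S) deg S x ^ 2)%N%:Z.
  rewrite Posz_sum; apply: eq_bigr => i iS; rewrite degsq.
  transitivity (\sum_(j in S) (i == j)%:R *
      \sum_(k in S) \sum_(l in S) t i j k l).
    apply: eq_bigr => j _; rewrite big_distrr /=; apply: eq_bigr => k _.
    by rewrite big_distrr.
  rewrite delta // expr2 big_distrl /=; apply: eq_bigr => k _.
  rewrite big_distrr /=; apply: eq_bigr => l _.
  by rewrite /t [a k i]a_sym [a l i]a_sym; ring.
have -> : X2 = (\sum_(x in S) deg S x ^ 2)%N%:Z.
  rewrite Posz_sum {}/X2 /s4.
  under eq_bigr => i _ do rewrite exchange_big /=.
  rewrite exchange_big /=; apply: eq_bigr => k kS; rewrite degsq expr2.
  rewrite big_distrl /=; apply: eq_bigr => i _.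
  rewrite big_distrr /=; apply: eq_bigr => j _.
  by rewrite delta // /t [a i k]a_sym [a j k]a_sym; ring.
have -> : X3 = (\sum_(x in S) deg S x)%N%:Z.
  rewrite Posz_sum {}/X3 /s4; apply: eq_bigr => i iS.
  transitivity (\sum_(j in S) (i == j)%:R *
      \sum_(k in S) \sum_(l in S) (k == l)%:R * t i j k l).
    apply: eq_bigr => j _; rewrite big_distrr /=; apply: eq_bigr => k _.
    by rewrite big_distrr.
  rewrite delta // degE; apply: eq_bigr => k kS; rewrite delta //.
  rewrite /t [a k i]a_sym -mulrA -expr2 -expr2 a_sqr.
  by case: (a i k != 0); rewrite ?mulr1 ?mulr0.
by ring.
Qed.

(** * Graphs with a vertex adjacent to all others *)

Lemma sum_support R (s : seq V) (F : V -> int) : uniq s -> {subset s <= R} ->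
  (forall x, x \in R -> x \notin s -> F x = 0) ->
  \sum_(x in R) F x = \sum_(x <- s) F x.
Proof.
move=> us sR F0; rewrite big_uniq //= big_mkcond [RHS]big_mkcond /=.
apply: eq_bigr => x _; have [xs|xs] := boolP (x \in s); first by rewrite sR.
by case: ifP => // xR; apply: F0.
Qed.

Lemma mem_arcs S x y : x \in S -> y \in S ->
  ((x, y) \in arcs S) = (a x y != 0).
Proof. by move=> xS yS; rewrite inE /= xS yS. Qed.

(* The second alternative describes two edges sharing the vertex [x1 = x2]. *)
Definition two_edges R x1 y1 x2 y2 :=
  arcs R = [set (x1, y1); (y1, x1); (x2, y2); (y2, x2)] /\
  (uniq [:: x1; y1; x2; y2] \/ x2 = x1 /\ uniq [:: x1; y1; y2]).

Lemma two_edges_uniq x1 y1 x2 y2 :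
  uniq [:: x1; y1; x2; y2] \/ x2 = x1 /\ uniq [:: x1; y1; y2] ->
  uniq [:: (x1, y1); (y1, x1); (x2, y2); (y2, x2)].
Proof.
move=> hu; rewrite /= !inE !xpair_eqE; case: hu => [|[-> ]]; rewrite /= !inE !negb_or.
  move=> /and3P[/and3P[n1 n2 n3] /andP[n4 n5] /andP[n6 _]].
  by rewrite (negPf n1) (negPf n2) (negPf n3) (negPf n4) (negPf n6) !andbF.
move=> /and3P[/andP[n1 n2] n3 _].
by rewrite (eq_sym y1 x1) ?(eq_sym y2 x1) (negPf n1) (negPf n2) (negPf n3) ?andbF.
Qed.

(** Degree sum 4 means four arcs, hence two edges. The cases are the possible coincidences of
    endpoints; each edge is reoriented so that a shared endpoint comes first. *)
Lemma two_edgesP R : (\sum_(x in R) deg R x = 4)%N ->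
  exists x1 y1 x2 y2, two_edges R x1 y1 x2 y2.
Proof.
rewrite -card_arcs => cR.
have swapR x y : ((x, y) \in arcs R) = ((y, x) \in arcs R).
  by rewrite !inE /= [a x y]a_sym andbCA.
have irrR x y : (x, y) \in arcs R -> x != y.
  by rewrite inE => /and3P[_ _ /adj_neq].
have [[x1 y1] p1] : exists p, p \in arcs R by apply/card_gt0P; rewrite cR.
have ne1 := irrR _ _ p1; have p1' := p1; rewrite swapR in p1'.
set A1 := [set (x1, y1); (y1, x1)].
have cA1 : #|A1| = 2%N by rewrite cards2 xpair_eqE (negPf ne1).
have A1R : A1 \subset arcs R by rewrite subUset !sub1set p1 p1'.
have [[x2 y2]] : exists p, p \in arcs R :\: A1.
  by apply/card_gt0P; rewrite cardsD (setIidPr A1R) cR cA1.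
rewrite !inE !xpair_eqE negb_or /= => /andP[/andP[n1 n2] /and3P[x2R y2R e2]].
have p2 : (x2, y2) \in arcs R by rewrite mem_arcs.
have ne2 := irrR _ _ p2; have p2' := p2; rewrite swapR in p2'.
have arcsR : arcs R = [set (x1, y1); (y1, x1); (x2, y2); (y2, x2)].
  apply/esym/eqP; rewrite eqEcard !subUset !sub1set p1 p2 p1' p2' /= cR.
  apply: (@uniq_size_le_card _ [:: (x1, y1); (y1, x1); (x2, y2); (y2, x2)]).
    rewrite /= !inE !xpair_eqE (eq_sym x1 x2) (eq_sym y1 y2) (eq_sym y1 x2).
    rewrite (eq_sym x1 y2) (eq_sym y1 x1) (eq_sym y2 x2).
    move: n1 n2 ne1 ne2; case: (x2 == x1); case: (y2 == y1);
      case: (x2 == y1); case: (y2 == x1); case: (x1 == y1);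
      by case: (x2 == y2).
  by move=> z; rewrite !inE -!orbA.
have := arcsR; have [x21|n21] := eqVneq x2 x1.
  move=> _; exists x1, y1, x2, y2; split; [exact: arcsR | right; split => //].
  rewrite /= !inE negb_or ne1 -x21 ne2 /= andbT eq_sym.
  by move: n1; rewrite x21 eqxx.
have [x2y1|n2y1] := eqVneq x2 y1.
  move=> _; exists y1, x1, x2, y2; split.
    by rewrite arcsR; congr (_ :|: _ :|: _); rewrite setUC.
  right; split => //; rewrite /= !inE negb_or eq_sym ne1 -x2y1 ne2 /= andbT eq_sym.
  by move: n2; rewrite x2y1 eqxx.
have [y2x1|n2x1] := eqVneq y2 x1.
  move=> _; exists x1, y1, y2, x2; split.
    by rewrite arcsR -!setUA; congr (_ :|: (_ :|: _)); rewrite setUC.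
  right; split => //; rewrite /= !inE negb_or ne1 -y2x1 eq_sym ne2 /= andbT.
  by rewrite eq_sym.
have [y2y1|n22] := eqVneq y2 y1.
  move=> _; exists y1, x1, y2, x2; split.
    rewrite arcsR (setUC [set (x1, y1)]) -!setUA; congr (_ :|: (_ :|: _)).
    by rewrite setUC.
  right; split => //; rewrite /= !inE negb_or eq_sym ne1 -y2y1 eq_sym ne2 /= andbT.
  by rewrite eq_sym.
move=> _; exists x1, y1, x2, y2; split; [exact: arcsR | left].
rewrite /= !inE !negb_or ne1 ne2 (eq_sym x1) n21 (eq_sym x1) n2x1.
by rewrite (eq_sym y1) n2y1 (eq_sym y1) n22.
Qed.

Definition unique_neighbour R x := x \in R -> forall y z, y \in R -> z \in R ->
  a x y != 0 -> a x z != 0 -> y = z.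

Lemma deg_le1 R x : x \in R -> unique_neighbour R x -> (deg R x <= 1)%N.
Proof.
move=> xR xu; apply/card_le1_eqP => y z; rewrite !inE.
by move=> /andP[yR xy] /andP[zR xz]; apply: xu.
Qed.

Lemma walk2_unique R u j : j \in R -> unique_neighbour R j ->
  (\sum_(k in R) a u k * a k j) ^+ 2 = \sum_(k in R) (a u k * a k j) ^+ 2.
Proof.
move=> jR ju; have [k /andP[kR jk]|none] := pickP [pred k in R | a j k != 0].
  have other l : l \in R :\ k -> a l j = 0.
    rewrite !inE => /andP[lk lR]; apply/eqP; rewrite a_sym.
    by apply: contraNT lk => jl; apply/eqP; apply: ju.
  rewrite !(sum_setD1 _ kR) !big1 ?addr0 // => l /other ->; last by rewrite mulr0.
  by rewrite mulr0 expr0n.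
have none' k : k \in R -> a k j = 0.
  by move=> kR; have := none k; rewrite /= kR a_sym => /negbT /negPn /eqP.
rewrite !big1 ?expr0n // => k /none' ->; last by rewrite mulr0.
by rewrite mulr0 expr0n.
Qed.

(** The sign of the triangle u-x-y, or 0 if it is not one. Switching preserves it, so at a vertex
    [u] adjacent to all others these signs describe the graph up to switching. *)
Definition tri_sign u x y := a u x * a x y * a y u.

Lemma tri_signC u x y : tri_sign u x y = tri_sign u y x.
Proof. by rewrite /tri_sign (a_sym y x) (a_sym u y) (a_sym u x); ring. Qed.

Section Star.
Variables (S : {set V}) (u : V).
Hypothesis uS : u \in S.
Hypothesis star : forall x, x \in S -> x != u -> a u x != 0.
Let R := S :\ u.

Let uR x : x \in R -> a u x != 0.
Proof. by rewrite !inE => /andP[xu xS]; apply: star. Qed.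

Lemma deg_centre : (deg S u).+1 = #|S|.
Proof.
rewrite (cardsD1 u S) uS add1n; congr _.+1; apply: eq_card => x; rewrite !inE.
have [->|xu] := eqVneq x u; first by rewrite a_irr eqxx andbF.
by have [xS|//] := boolP (x \in S); rewrite star.
Qed.

Lemma deg_rim x : x \in R -> deg S x = (deg R x).+1.
Proof. by move=> xR; rewrite (deg_setD1 x uS) adjC uR // addn1. Qed.

Lemma sum_deg_rim : (\sum_(x in S) deg S x = 2 * #|S|.+1)%N ->
  (\sum_(x in R) deg R x = 4)%N.
Proof. by have := deg_centre; rewrite (sum_deg_setD1 uS) -/R; lia. Qed.

Lemma sum_deg_sqr_star : (\sum_(x in R) deg R x = 4)%N ->
  (\sum_(x in S) deg S x ^ 2
   = #|S|.-1 ^ 2 + #|S|.-1 + 8 + \sum_(x in R) deg R x ^ 2)%N.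
Proof.
move=> sum4; rewrite (big_setD1 u uS) /= -/R.
have -> : deg S u = #|S|.-1 by rewrite -deg_centre.
rewrite (eq_bigr (fun x => deg R x ^ 2 + (2 * deg R x + 1)))%N => [|x /deg_rim->];
  last by lia.
have cR : #|R| = #|S|.-1 by rewrite (cardsD1 u S) uS.
by rewrite !big_split /= sum4 big1_eq sum_nat_const muln1 cR; lia.
Qed.

Variables x1 y1 x2 y2 : V.
Hypothesis edgesR : two_edges R x1 y1 x2 y2.

Let in_arcs x y : x \in R -> y \in R -> (a x y != 0) =
  [|| (x, y) == (x1, y1), (x, y) == (y1, x1), (x, y) == (x2, y2)
    | (x, y) == (y2, x2)].
Proof.
move=> xR yR; rewrite -(mem_arcs xR yR).
by case: edgesR => -> _; rewrite !inE -!orbA.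
Qed.

Lemma two_edges_mem : [/\ x1 \in R, y1 \in R, x2 \in R & y2 \in R].
Proof.
have e1 : (x1, y1) \in arcs R by case: edgesR => -> _; rewrite !inE eqxx.
have e2 : (x2, y2) \in arcs R by case: edgesR => -> _; rewrite !inE eqxx !orbT.
have memR x y : (x, y) \in arcs R -> x \in R /\ y \in R.
  by rewrite inE => /and3P[].
by have [] := memR _ _ e1; have [] := memR _ _ e2.
Qed.

Lemma two_edges_arcs4 : (#|arcs R| <= 4)%N.
Proof.
pose s := [:: (x1, y1); (y1, x1); (x2, y2); (y2, x2)].
case: edgesR => arcsR _; apply: leq_trans (card_size s).
by apply: subset_leq_card; apply/subsetP => p; rewrite arcsR !inE -!orbA.
Qed.

Lemma tri_star : tri S = 6 * (tri_sign u x1 y1 + tri_sign u x2 y2).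
Proof.
have [triR _] := few_arcs two_edges_arcs4.
rewrite (tri_setD1 uS) -/R triR add0r.
have [x1R y1R x2R y2R] := two_edges_mem.
have -> : \sum_(j in R) \sum_(k in R) a u j * a j k * a k u
    = \sum_(p in arcs R) tri_sign u p.1 p.2.
  rewrite pair_big big_mkcond [RHS]big_mkcond /=; apply: eq_bigr => -[j k] _.
  rewrite arcsE /=; case: (j \in R) => //=; case: (k \in R) => //=.
  by have [-> /=|] := eqVneq (a j k) 0; rewrite ?mulr0 ?mul0r.
case: edgesR => arcsR hu.
have neq := two_edges_uniq hu.
have -> : \sum_(p in arcs R) tri_sign u p.1 p.2
    = \sum_(p <- [:: (x1, y1); (y1, x1); (x2, y2); (y2, x2)]) tri_sign u p.1 p.2.
  by rewrite arcsR big_uniq //=; apply: eq_bigl => p; rewrite !inE -!orbA.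
by rewrite !big_cons big_nil /= (tri_signC u y1) (tri_signC u y2); ring.
Qed.

(** A 4-cycle through [u] would need an opposite corner with two neighbours in [R], and no vertex
    has them. *)
Lemma star_disjoint : uniq [:: x1; y1; x2; y2] ->
  quad S = 0 /\ forall x, x \in R -> (deg R x <= 1)%N.
Proof.
move=> un; have nbr_uniq x : unique_neighbour R x.
  move=> xR y z yR zR; rewrite !in_arcs // !xpair_eqE; move: un.
  rewrite /= !inE !negb_or -!andbA => /and4P[n1 n2 n3 /and3P[n4 n5 n6]].
  by case/or4P=> /andP[/eqP-> /eqP->] /or4P[] /andP[/eqP e1 /eqP e2];
     move: n1 n2 n3 n4 n5 n6; rewrite -?e1 -?e2 ?eqxx.
split=> [|x xR]; last exact: deg_le1.
have [_ quadR] := few_arcs two_edges_arcs4.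
rewrite (quad_setD1 uS) -/R quadR add0r big1 ?mulr0 // => j jR.
by rewrite walk2_unique ?subrr.
Qed.

(** The only 4-cycle is u-y1-x1-y2. Its sign is the product of the two triangle signs, which are
    opposite since [tri S = 0]; its eight closed walks give -8. *)
Lemma star_shared : x2 = x1 -> uniq [:: x1; y1; y2] -> tri S = 0 ->
  [/\ quad S = - 8, deg R x1 = 2%N
    & forall x, x \in R -> x != x1 -> (deg R x <= 1)%N].
Proof.
move=> x21; rewrite /= !inE negb_or andbT => /andP[/andP[n1 n2] n3] tri0.
have [x1R y1R _ y2R] := two_edges_mem.
have arcsR x y : x \in R -> y \in R -> (a x y != 0) =
    [|| (x == x1) && (y == y1), (x == y1) && (y == x1),
        (x == x1) && (y == y2) | (x == y2) && (y == x1)].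
  by move=> xR yR; rewrite in_arcs // !xpair_eqE x21.
have nbr_uniq x : x != x1 -> unique_neighbour R x.
  move=> /negPf xx1 xR y z yR zR; rewrite !arcsR // xx1 /=.
  by case/orP=> /andP[_ /eqP->] /orP[] /andP[_ /eqP->].
have degx1 : deg R x1 = 2%N.
  rewrite /deg (_ : [set y in R | _] = [set y1; y2]) ?cards2 ?n3 //.
  apply/setP=> y; rewrite [in LHS]inE !in_set2.
  have [yR|yR] := boolP (y \in R).
    by rewrite arcsR // eqxx (negPf n1) (negPf n2) /= orbF.
  by symmetry; apply: contraNF yR => /orP[] /eqP->.
split=> // [|x xR xx1]; last by apply: deg_le1 => //; apply: nbr_uniq.
have [_ quadR] := few_arcs two_edges_arcs4.
rewrite (quad_setD1 uS) -/R quadR add0r (sum_setD1 _ x1R).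
rewrite [X in _ * (_ + X)]big1 ?addr0; last first.
  by move=> j /setD1P[jx1 jR]; rewrite walk2_unique ?subrr //; apply: nbr_uniq.
have sup (F : V -> int) : (forall x, x \in R -> a x x1 = 0 -> F x = 0) ->
    \sum_(k in R) F k = F y1 + F y2.
  move=> F0; rewrite (@sum_support R [:: y1; y2]) /= ?inE ?n3 //.
  - by rewrite !big_cons big_nil addr0.
  - by move=> x; rewrite in_cons mem_seq1 => /orP[] /eqP->.
  move=> x xR; rewrite in_cons mem_seq1 negb_or => /andP[xy1 xy2].
  apply: F0 => //.
  apply/eqP; rewrite -[_ == _]negbK arcsR // (negPf xy1) (negPf xy2) (negPf n1).
  by rewrite (negPf n2) !andbF.
rewrite !sup; try by move=> x _ ->; rewrite mulr0 ?expr0n.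
have e1 : a y1 x1 ^+ 2 = 1 by rewrite a_sqr arcsR // !eqxx orbT.
have e2 : a y2 x1 ^+ 2 = 1 by rewrite a_sqr arcsR // !eqxx !orbT.
have u0 : a u x1 ^+ 2 = 1 by rewrite a_sqr uR.
have u1 : a u y1 ^+ 2 = 1 by rewrite a_sqr uR.
have u2 : a u y2 ^+ 2 = 1 by rewrite a_sqr uR.
have := tri0; rewrite tri_star x21 /tri_sign => /eqP; rewrite mulf_eq0 /=.
rewrite (a_sym x1 y1) (a_sym x1 y2) (a_sym y1 u) (a_sym y2 u) => /eqP t0.
have {t0} t0 : a u y1 * a y1 x1 = - (a u y2 * a y2 x1).
  apply/eqP; rewrite -addr_eq0 -[X in X == 0]mul1r -u0 expr2 -mulrA.
  by rewrite mulrDr; apply/eqP; rewrite -[RHS](mulr0 (a u x1)) -t0; ring.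
by rewrite !t0 exprMn e2 u2 ?mulr1 sqrrN exprMn u2 e2; ring.
Qed.

End Star.

Lemma deg_lt S u : u \in S -> (deg S u < #|S|)%N.
Proof.
move=> uS; rewrite [ltnRHS](cardsD1 u) uS add1n ltnS.
rewrite /deg; apply: subset_leq_card; apply/subsetP => x; rewrite !inE.
by move=> /andP[-> /adj_neq]; rewrite eq_sym => ->.
Qed.

Lemma full_deg S u : u \in S -> (deg S u).+1 = #|S| ->
  forall x, x \in S -> x != u -> a u x != 0.
Proof.
move=> uS; rewrite (cardsD1 u S) uS add1n => -[degu] x xS xu.
have sub : [set y in S | a u y != 0] \subset S :\ u.
  by apply/subsetP => y; rewrite !inE => /andP[-> /adj_neq]; rewrite eq_sym => ->.
have /eqP/setP/(_ x) : [set y in S | a u y != 0] == S :\ u.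
  by rewrite eqEcard sub -degu leqnn.
by rewrite !inE xS xu.
Qed.

(** * Graphs of minimum degree 2 *)

Lemma sum_excess S : (forall x, x \in S -> 2 <= deg S x)%N ->
  (\sum_(x in S) deg S x = 2 * #|S|.+1)%N ->
  (\sum_(x in S) (deg S x - 2) = 2)%N.
Proof.
move=> ge2 sumS; have : (\sum_(x in S) (deg S x - 2 + 2) = 2 * #|S|.+1)%N.
  by rewrite -sumS; apply: eq_bigr => x /ge2; lia.
by rewrite big_split /= sum_nat_const; lia.
Qed.

(** The degrees exceed 2 by 2 in total, so there are either two vertices of degree 3 or one of
    degree 4. *)
Lemma core_deg_sqr S : (forall x, x \in S -> 2 <= deg S x)%N ->
  (\sum_(x in S) deg S x = 2 * #|S|.+1)%N ->
  (\sum_(x in S) deg S x ^ 2 = 4 * #|S| + 10)%N \/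
  (\sum_(x in S) deg S x ^ 2 = 4 * #|S| + 12)%N
    /\ exists2 p, p \in S & deg S p = 4%N.
Proof.
move=> ge2 sumS; have exc := sum_excess ge2 sumS.
have [p /andP[pS p4]|none] := pickP [pred x in S | 4 <= deg S x]%N.
  right; move: exc; rewrite (big_setD1 p pS) /= => exc.
  have /eqP : (\sum_(x in S :\ p) (deg S x - 2) = 0)%N by lia.
  rewrite sum_nat_eq0 => /forall_inP deg2.
  have degp : deg S p = 4%N by lia.
  split; last by exists p.
  rewrite (big_setD1 p pS) /= degp (eq_bigr (fun=> 4%N)) => [|x xSp].
    by rewrite sum_nat_const (cardsD1 p S) pS; lia.
  have xS : x \in S by move: xSp; rewrite inE => /andP[].
  by have := ge2 x xS; have /eqP := deg2 x xSp; move: (deg S x) => k k2 k3;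
     rewrite (_ : k = 2)%N //; lia.
(* For d = 2 and d = 3 one has d^2 + 6 = 5 d, so the sum of squares follows from the sum of
   degrees. *)
left; have : (\sum_(x in S) (deg S x ^ 2 + 6) = \sum_(x in S) 5 * deg S x)%N.
  apply: eq_bigr => x xS; have := ge2 x xS; have := none x; rewrite /= xS /=.
  by case: (deg S x) => [|[|[|[|k]]]].
by rewrite big_split /= -big_distrr /= sumS sum_nat_const; lia.
Qed.

Section NearStar.
Variables (S : {set V}) (p : V).
Hypothesis ge2 : forall x, x \in S -> (2 <= deg S x)%N.
Hypothesis sumS : (\sum_(x in S) deg S x = 2 * #|S|.+1)%N.
Hypothesis pS : p \in S.
Hypothesis deg_p : (deg S p).+2 = #|S|.
Hypothesis card_ge5 : (5 <= #|S|)%N.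
Hypothesis triS : tri S = 0.
Hypothesis quadS : quad S <= 8.
Let R := S :\ p.
Let N := [set y in S | a p y != 0].

Lemma near_star_nonneighbour : exists z, [/\ z \in R, a p z = 0 & N = R :\ z].
Proof.
have NR : N \subset R.
  by apply/subsetP => y; rewrite !inE => /andP[-> /adj_neq]; rewrite eq_sym => ->.
have /eqP/cards1P [z zE] : #|R :\: N| = 1%N.
  rewrite cardsD (setIidPr NR) -/(deg S p); move: deg_p.
  by rewrite (cardsD1 p S) pS -/R; lia.
have : z \in R :\: N by rewrite zE inE.
rewrite inE => /andP[zN zR]; exists z; split => //.
  have zS : z \in S by move: zR; rewrite inE => /andP[].
  by apply/eqP; apply: contraNT zN => pz; rewrite inE zS.
by rewrite -zE setDDr setDv set0U (setIidPr NR).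
Qed.

(** By [deg_p] and [card_ge5] the vertex [p] has degree at least 3 as well, so the total excess over
    2 would be at least 3. *)
Lemma core_two_big x y : x \in R -> y \in R -> x != y ->
  (3 <= deg S x)%N -> (3 <= deg S y)%N -> False.
Proof.
move=> xR yR xy x3 y3; have := sum_excess ge2 sumS.
have yRx : y \in R :\ x by rewrite !inE eq_sym xy; move: yR; rewrite !inE.
rewrite (big_setD1 p pS) /= (big_setD1 x xR) /= (big_setD1 y yRx) /=.
by lia.
Qed.

(* Let z be the only vertex besides p not adjacent to p. The neighbours of p
   span 3 - deg z edges. If there is one, it closes the only triangle,
   contradicting [tri S = 0]; if there is none, the graph is K_{2,3}, and
   [quad S] is 4 (b ^ 2 - 3) with b odd. *)
Lemma near_star_core : #|S| = 5%N /\ quad S = - 8.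
Proof.
have [z [zR pz NE]] := near_star_nonneighbour.
have zS : z \in S by move: zR; rewrite inE => /andP[].
have zN : z \notin N by rewrite inE pz eqxx andbF.
have memN y : y \in N -> [/\ y \in S, y \in R & a p y != 0].
  by move=> yN; have := yN; rewrite {1}NE !inE => /and3P[_ -> ->]; move: yN;
     rewrite inE => /andP[].
have cN : (#|N|.+2 = #|S|)%N by [].
have inN x : (x \in N) = (x != z) && (x \in R) by rewrite NE in_setD1.
have degRz : deg R z = deg S z by rewrite (deg_setD1 z pS) a_sym pz eqxx addn0.
have degN y : y \in N -> deg S y = (deg N y + 1 + (a y z != 0))%N.
  move=> /memN[yS yR py]; rewrite (deg_setD1 y pS) -/R (deg_setD1 y zR) -NE.
  by rewrite (adjC y p) py addnAC.
have sumN : (\sum_(y in N) deg N y + 2 * deg S z = 6)%N.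
  move: sumS; rewrite (sum_deg_setD1 pS) -/R (sum_deg_setD1 zR) -NE degRz.
  by move: deg_p; lia.
have z2 := ge2 zS.
have [dz|dz] : deg S z = 2%N \/ deg S z = 3%N by lia.
  exfalso.
  have cardN : #|arcs N| = 2%N by rewrite card_arcs; lia.
  have [[c d] cd] : exists q, q \in arcs N by apply/card_gt0P; rewrite cardN.
  move: (cd); rewrite arcsE => /and3P[cN' dN acd].
  have arcsN : arcs N = [set (c, d); (d, c)].
    apply/esym/eqP; rewrite eqEcard cardN cards2 xpair_eqE (negPf (adj_neq acd)).
    by rewrite subUset !sub1set cd arcsE dN cN' adjC acd.
  (* Apart from [z], each vertex of a triangle avoiding [p] also has [p] as neighbour, hence degree
     at least 3. Two of the three vertices differ from [z], against [core_two_big]. *)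
  have tri_deg x y w : x \in R -> y \in R -> w \in R -> y != w ->
      a x y != 0 -> a x w != 0 -> x != z -> (3 <= deg S x)%N.
    move=> xR yR wR yw xy xw xz; rewrite (deg_setD1 x pS) -/R.
    have xN : x \in N by rewrite inN xz.
    have [_ _ px] := memN x xN.
    have : (#|[set y; w]| <= deg R x)%N.
      apply: subset_leq_card; apply/subsetP => v /set2P[] ->;
        by rewrite inE ?yR ?wR.
    by rewrite cards2 yw (adjC x p) px addn1.
  have triR : tri R = 0.
    apply: tri_eq0 => i j k iR jR kR ij jk ki.
    have [nij njk nki] := And3 (adj_neq ij) (adj_neq jk) (adj_neq ki).
    have [ji kj ik] : [/\ a j i != 0, a k j != 0 & a i k != 0].
      by rewrite (adjC j i) (adjC k j) (adjC i k).
    have i3 : i != z -> (3 <= deg S i)%N.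
      by apply: (tri_deg i j k).
    have j3 : j != z -> (3 <= deg S j)%N.
      by apply: (tri_deg j k i).
    have k3 : k != z -> (3 <= deg S k)%N.
      by apply: (tri_deg k i j).
    have [iz|iz] := eqVneq i z.
      apply: (core_two_big jR kR njk); first by apply: j3; rewrite -iz eq_sym.
      by apply: k3; rewrite -iz.
    have [jz|jz] := eqVneq j z.
      by apply: (core_two_big iR kR _ (i3 iz)); rewrite 1?eq_sym ?k3 // -jz eq_sym.
    exact: (core_two_big iR jR nij (i3 iz) (j3 jz)).
  have := triS; rewrite (tri_setD1 pS) -/R triR add0r => /eqP; rewrite mulf_eq0 /=.
  have -> : \sum_(j in R) \sum_(k in R) a p j * a j k * a k p
      = \sum_(q in arcs N) tri_sign p q.1 q.2.
    rewrite pair_big big_mkcond [RHS]big_mkcond /=; apply: eq_bigr => -[j k] _.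
    rewrite arcsE /= !inN; have [->|jz] := eqVneq j z.
      by rewrite pz !mul0r; case: ifP.
    have [->|kz] := eqVneq k z.
      by rewrite (a_sym z p) pz mulr0 andbF; case: ifP.
    case: (j \in R) => //=; case: (k \in R) => //=.
    by have [-> /=|] := eqVneq (a j k) 0; rewrite ?mulr0 ?mul0r.
  rewrite arcsN big_setU1 ?inE ?xpair_eqE ?(negPf (adj_neq acd)) //= big_set1 /=.
  rewrite /tri_sign (a_sym d c) (a_sym p c) (a_sym p d).
  have [_ _ pc] := memN c cN'; have [_ _ pd] := memN d dN.
  have : a c p * a c d * a d p != 0 by rewrite !mulf_neq0 // adjC.
  by lia.
have arcsN0 : #|arcs N| = 0%N by rewrite card_arcs; lia.
have noN x y : x \in N -> y \in N -> a x y = 0.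
  move=> xN yN; apply/eqP; rewrite -[_ == _]negbK -(mem_arcs xN yN).
  by rewrite (card0_eq arcsN0).
have degN0 y : y \in N -> deg N y = 0%N.
  by move=> yN; apply: eq_card0 => x; rewrite inE; case: (boolP (x \in N)) => //= xN;
     rewrite noN // eqxx.
have zy y : y \in N -> a z y != 0.
  move=> yN; have [yS _ _] := memN y yN; have := ge2 yS.
  by rewrite degN // degN0 // (adjC y z); case: (a z y != 0).
have cN3 : #|N| = 3%N.
  rewrite -dz -degRz; apply: eq_card => y; rewrite [RHS]inE inN.
  have [->|yz] := eqVneq y z; first by rewrite a_irr eqxx andbF.
  have [yR|yR] := boolP (y \in R); last by rewrite andbF.
  by rewrite zy // inN yz yR.
have card5 : #|S| = 5%N by rewrite -cN cN3.
split=> //.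
have quadN : quad N = 0 by have [] := @few_arcs N; rewrite ?arcsN0.
have quadR : quad R = 0.
  rewrite (quad_setD1 zR) -NE quadN add0r big1 ?mulr0 // => j jN.
  by rewrite !big1 ?expr0n ?subrr // => k kN; rewrite (noN k j) // mulr0 ?expr0n.
have quadE : quad S = 4 * ((\sum_(k in N) a p k * a k z) ^+ 2 - 3).
  rewrite (quad_setD1 pS) -/R quadR add0r (sum_setD1 _ zR) -NE.
  rewrite [X in _ * (_ + X) = _]big1 ?addr0 => [|j jN]; last first.
    rewrite !(sum_setD1 _ zR) -NE pz mul0r expr0n !add0r.
    by rewrite !big1 ?expr0n ?subrr // => k kN; rewrite (noN k j) // mulr0 ?expr0n.
  rewrite !(sum_setD1 _ zR) -NE pz mul0r expr0n !add0r; congr (_ * (_ - _)).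
  transitivity (\sum_(k in N) (1 : int)).
    apply: eq_bigr => k kN; have [_ _ pk] := memN k kN.
    by rewrite exprMn !a_sqr pk (adjC k z) zy.
  by rewrite sumr_const cN3.
pose h k : int := if a p k * a k z == 1 then 0 else 1.
have oddB : \sum_(k in N) a p k * a k z = 3 - 2 * \sum_(k in N) h k.
  transitivity (\sum_(k in N) (1 - 2 * h k)).
    apply: eq_bigr => k kN; have [_ _ pk] := memN k kN.
    have : (a p k * a k z) ^+ 2 = 1 by rewrite exprMn !a_sqr pk (adjC k z) zy.
    move=> /eqP; rewrite sqrf_eq1 /h => /orP[] /eqP ->; first by rewrite eqxx.
    by [].
  by rewrite sumrB -big_distrr /= sumr_const cN3.
move: quadS; rewrite quadE oddB; move: (\sum_(k in N) h k) => H.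
rewrite expr2 => le8.
(* With b = 3 - 2 H, where H counts the negative paths from [p] to [z], the bound [quadS] gives b^2
   <= 5, so b is 1 or -1. *)
have [->|->] : H = 1 \/ H = 2; [by nia | by [] | by []].
Qed.

End NearStar.

(** * Bounds for the fourth moment *)

(* The fourth spectral moment is [weight setT] minus twice the number of edges. *)
Definition weight S : int := 2 * (\sum_(x in S) deg S x ^ 2)%N%:Z + quad S.

Section StarWeight.
Variables (S : {set V}) (u x1 y1 x2 y2 : V).
Hypothesis uS : u \in S.
Hypothesis star : forall x, x \in S -> x != u -> a u x != 0.
Hypothesis edgesR : two_edges (S :\ u) x1 y1 x2 y2.

Lemma sum_deg_two_edges : (\sum_(x in S :\ u) deg (S :\ u) x = 4)%N.
Proof.
rewrite -card_arcs; case: edgesR => -> hu.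
have us := two_edges_uniq hu.
rewrite -[RHS]/(size [:: (x1, y1); (y1, x1); (x2, y2); (y2, x2)]).
by rewrite -(card_uniqP us); apply: eq_card => p; rewrite !inE -!orbA.
Qed.

Lemma sum_deg_star : (\sum_(x in S) deg S x = 2 * #|S|.+1)%N.
Proof.
by rewrite (sum_deg_setD1 uS) sum_deg_two_edges -(deg_centre uS star); lia.
Qed.

Lemma star_weight_disjoint : uniq [:: x1; y1; x2; y2] ->
  [/\ weight S = 2 * (#|S|.-1 ^ 2 + #|S|.-1 + 12)%N%:Z, (5 <= #|S|)%N
    & forall x, x \in S -> x != u -> (deg S x <= 2)%N].
Proof.
move=> un; have sumR := sum_deg_two_edges.
have [quad0 deg1] := star_disjoint uS edgesR un.
have [x1R y1R x2R y2R] := two_edges_mem edgesR.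
split.
- rewrite /weight quad0 addr0 (sum_deg_sqr_star uS star sumR).
  rewrite (eq_bigr (deg (S :\ u))) ?sumR => [|x /deg1]; first by lia.
  by case: (deg _ x) => [|[|k]].
- rewrite (cardsD1 u) uS add1n ltnS.
  apply: leq_trans (uniq_size_le_card un _) => // x.
  by rewrite !in_cons in_nil orbF => /or4P[] /eqP->.
- by move=> x xS xu; rewrite (deg_rim uS star) ?ltnS ?deg1 ?in_setD1 ?xu.
Qed.

(** Compared with disjoint edges, the degrees 2, 1, 1 in [R] raise the sum of squares by 2, while
    [quad S = - 8] takes away 4 after halving; so 12 becomes 10. *)
Lemma star_weight_shared : x2 = x1 -> uniq [:: x1; y1; y2] -> tri S = 0 ->
  weight S = 2 * (#|S|.-1 ^ 2 + #|S|.-1 + 10)%N%:Z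
  /\ forall x, x \in S -> x != u -> (deg S x <= 3)%N.
Proof.
move=> x21 un triS; have sumR := sum_deg_two_edges.
have [quad8 degx1 deg1] := star_shared uS star edgesR x21 un triS.
have [x1R _ _ _] := two_edges_mem edgesR.
split; last first.
  move=> x xS xu; have xR : x \in S :\ u by rewrite in_setD1 xu.
  rewrite (deg_rim uS star) // ltnS.
  have [->|xx1] := eqVneq x x1; first by rewrite degx1.
  exact: leq_trans (deg1 x _ xx1) _.
rewrite /weight quad8 (sum_deg_sqr_star uS star sumR); move: sumR.
rewrite !(big_setD1 x1 x1R) /= degx1 => sumR'.
rewrite (eq_bigr (deg (S :\ u))) => [|x /setD1P[xx1 xR]]; first by lia.
by have := deg1 x xR xx1; case: (deg _ x) => [|[|k]].
Qed.

End StarWeight.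

(** With m vertices the weight is at most 8 m + 32, which suffices from m = 7 on. For m = 5 the
    vertices of degree 3 make [near_star_core] apply, and the weight is 52. For m = 6 the same lemma
    excludes a vertex of degree 4; what remains is at most 76, and this exceeds the quadratic term
    72 by the extra 4. *)
Lemma core_weight S : (forall x, x \in S -> 2 <= deg S x)%N ->
  (\sum_(x in S) deg S x = 2 * #|S|.+1)%N -> tri S = 0 -> quad S <= 8 ->
  (5 <= #|S|)%N -> (forall x, x \in S -> (deg S x).+2 <= #|S|)%N ->
  weight S <= 2 * (#|S| ^ 2 - #|S| + 6)%N%:Z + (if (#|S| <= 6)%N then 4 else 0).
Proof.
move=> ge2 sumS triS quadS ge5 Delta; rewrite /weight.
have near p : p \in S -> (deg S p).+2 = #|S| -> #|S| = 5%N /\ quad S = -8.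
  by move=> pS dp; apply: (near_star_core ge2 sumS pS).
have [m7|m6] := leqP 7 #|S|.
  have [->|[-> _]] := core_deg_sqr ge2 sumS; case: ifP => _; nia.
have [m5|m6'] := eqVneq #|S| 5%N.
  have [sq|[sq [p pS p4]]] := core_deg_sqr ge2 sumS; last first.
    by have := Delta p pS; rewrite p4 m5.
  have [p /andP[pS p3]|none] := pickP [pred x in S | deg S x == 3]%N.
    have [|_ ->] := near p pS; first by rewrite (eqP p3) m5.
    by rewrite sq m5.
  have : (\sum_(x in S) deg S x <= \sum_(x in S) 2)%N.
    apply: leq_sum => x xS; have := Delta x xS; have := none x.
    by rewrite /= xS m5; case: (deg S x) => [|[|[|[|k]]]].
  by rewrite sumS sum_nat_const m5.
have m6E : #|S| = 6%N by lia.
have [sq|[sq [p pS p4]]] := core_deg_sqr ge2 sumS.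
  by rewrite sq m6E leqnn; lia.
by have [|] := near p pS; rewrite ?p4 m6E.
Qed.

(** Adding a pendant vertex to reach m vertices increases the weight by at most 4 m - 8, while the
    quadratic bound grows by 4 m - 4. The slack of 4 absorbs the extra 4 in passing from m = 6 to m
    = 7. For m = 5 the extra 4 is needed when a pendant vertex is attached to a vertex of degree 2
    of two triangles sharing an edge. *)
Lemma weight_bound S : (forall X, quad X <= 8) ->
  (5 <= #|S|)%N -> cut_connected S ->
  (\sum_(x in S) deg S x = 2 * #|S|.+1)%N -> tri S = 0 ->
  (forall x, x \in S -> (deg S x).+2 <= #|S|)%N ->
  weight S <= 2 * (#|S| ^ 2 - #|S| + 6)%N%:Z + (if (#|S| <= 6)%N then 4 else 0).
Proof.
move=> quad8; have [m] := ubnP #|S|; elim: m S => // m IH S.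
rewrite ltnS => cSm ge5 conS sumS triS Delta.
have [w /andP[wS dw]|none] := pickP [pred x in S | deg S x < 2]%N; last first.
  by apply: core_weight => // x xS; have := none x; rewrite /= xS; lia.
have {}dw : deg S w = 1%N.
  have [|||x [y [/set1P-> yS _ wy]]] := conS [set w].
  - by rewrite sub1set.
  - by apply/set0Pn; exists w; rewrite inE.
  - by apply: contraTneq ge5 => <-; rewrite cards1.
  by have := degP yS wy; move: dw; lia.
have [x [xR wx _]] := leaf_neighbour dw.
have xS : x \in S by move: xR; rewrite inE => /andP[].
set R := S :\ w in xR *.
have cS : #|S| = #|R|.+1 by rewrite (cardsD1 w) wS.
have sumR : (\sum_(y in R) deg R y = 2 * #|R|.+1)%N.
  by move: sumS; rewrite (sum_deg_setD1 wS) -/R dw cS; lia.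
have triR : tri R = 0 by rewrite -(tri_leaf wS dw).
have weightS : weight S = weight R + (4 * deg R x + 4)%N%:Z.
  rewrite /weight (sum_deg_sqr_leaf wS dw xR wx) (quad_leaf wS dw) -/R; lia.
have dx : ((deg R x).+3 <= #|S|)%N.
  by have := Delta x xS; rewrite (deg_setD1 x wS) -/R (adjC x w) wx addn1.
(* Removing [w] may create a vertex [u] adjacent to all others. As [S] has none, [w] hangs at some
   [x] other than [u], whose degree is small. *)
have [u /andP[uR /eqP du]|noful] := pickP [pred u in R | (deg R u).+1 == #|R|].
  have xu : x != u by apply/eqP => xu; move: dx; rewrite xu cS -du ltnn.
  have star := full_deg uR du.
  have [x1 [y1 [x2 [y2 E]]]] := two_edgesP (sum_deg_rim uR star sumR).
  case: (E) => _ [un|[x21 un]].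
    have [wR c5 d2] := star_weight_disjoint uR star E un.
    have := d2 x xR xu; rewrite weightS wR cS.
    by move: #|R| c5 => r; case: ifP; nia.
  have [wR d3] := star_weight_shared uR star E x21 un triR.
  have := d3 x xR xu; rewrite weightS wR; move: dx; rewrite cS.
  by move: ge5; rewrite cS; move: #|R| => r; case: ifP; nia.
have DeltaR y : y \in R -> ((deg R y).+2 <= #|R|)%N.
  move=> yR; have := deg_lt yR; have := noful y; rewrite /= yR /=.
  by rewrite leq_eqVlt => ->.
(* With at most four vertices all degrees in [R] would be at most 2, too small for |R| + 1 edges. *)
have c5 : (5 <= #|R|)%N.
  rewrite ltnNge; apply/negP => c4.
  have : (\sum_(y in R) deg R y <= \sum_(y in R) 2)%N.
    by apply: leq_sum => y /DeltaR; lia.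
  by rewrite sumR sum_nat_const; lia.
have := IH R _ c5 (cut_connected_leaf wS dw conS) sumR triR DeltaR.
move/(_ ltac:(lia)); rewrite weightS cS; move: dx; rewrite cS.
move: c5; move: #|R| => r c5 dx.
by case: ifP; case: ifP; nia.
Qed.

(** * At most one positive 4-cycle *)

(* An edge weighting that is a left null vector of the signed incidence
   matrix: [Y x y] is the contribution of the edge [xy] at its endpoint [x]. *)
Definition circulation (Y : V -> V -> rat) :=
  [/\ forall x y, Y y x = - ((a x y)%:~R * Y x y),
      forall x y, a x y = 0 -> Y x y = 0
    & forall x, \sum_y Y x y = 0].

Section Circulations.
Hypothesis unpotential : forall f : V -> rat,
  (forall x y, a x y != 0 -> f x = (a x y)%:~R * f y) -> forall x, f x = 0.
Hypothesis bicyclic_arcs : #|arcs [set: V]| = (2 * #|V|.+1)%N.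

Let D := [set p in arcs [set: V] | (enum_rank p.1 < enum_rank p.2)%N].

Let sum_arcs (F : V * V -> rat) : (forall x y, a x y = 0 -> F (x, y) = 0) ->
  \sum_x \sum_y F (x, y) = \sum_(p in D) (F p + F (p.2, p.1)).
Proof.
move=> F0; rewrite pair_big /=.
rewrite (bigID (fun p : V * V => (enum_rank p.1 < enum_rank p.2)%N)) /= big_split /=.
congr (_ + _).
  rewrite big_mkcond [RHS]big_mkcond /=; apply: eq_bigr => -[x y] _ /=.
  rewrite !inE /=; have [/F0->|] := eqVneq (a x y) 0; first by rewrite /= if_same.
  by [].
rewrite (reindex (fun p : V * V => (p.2, p.1))) /=; last first.
  by exists (fun p : V * V => (p.2, p.1)) => -[].
rewrite big_mkcond [RHS]big_mkcond /=; apply: eq_bigr => -[x y] _ /=.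
rewrite !inE /=; have [xy|xy] := eqVneq (a x y) 0.
  by rewrite F0 ?if_same // a_sym.
rewrite -leqNgt leq_eqVlt val_eqE (inj_eq enum_rank_inj).
by rewrite (negPf (adj_neq xy)).
Qed.

Let cardD : #|D| = #|V|.+1.
Proof.
have : \sum_x \sum_y (a x y != 0)%:R = (#|arcs [set: V]|)%:R :> rat.
  rewrite pair_big -sum1_card natr_sum [RHS]big_mkcond /=.
  by apply: eq_bigr => -[x y] _; rewrite inE /= !inE /=; case: eqP.
rewrite (@sum_arcs (fun p => (a p.1 p.2 != 0)%:R)) => [|x y /= ->]; last first.
  by rewrite eqxx.
rewrite (eq_bigr (fun=> 2%:R)) => [|-[x y]].
  rewrite sumr_const -mulrnA bicyclic_arcs => /eqP.
  by rewrite eqr_nat eqn_mul2l => /eqP.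
by rewrite !inE /= (a_sym y x) => /andP[-> _].
Qed.

(** [D] orients each edge once and indexes the rows of the incidence matrix [B]. The column vectors
    killed by [B] are the potentials, so [unpotential] gives rank |V|. As there is one more row than
    columns, the left kernel is a line, and it contains [vec Y] and [vec Y']. *)
Lemma circulation_unique Y Y' : circulation Y -> circulation Y' ->
  (exists x y, Y x y != 0) -> exists c, forall x y, Y' x y = c * Y x y.
Proof.
pose B : 'M[rat]_(#|D|, #|V|) := \matrix_(r, c)
  ((enum_val c == (enum_val r).1)%:R
   - (a (enum_val r).1 (enum_val r).2)%:~R * (enum_val c == (enum_val r).2)%:R).
pose vec (Z : V -> V -> rat) : 'rV_#|D| :=
  \row_r Z (enum_val r).1 (enum_val r).2.
have vecB Z : circulation Z -> vec Z *m B = 0.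
  move=> [Zanti Z0 Zsum]; apply/rowP => c; rewrite !mxE.
  set z := enum_val c.
  transitivity (\sum_(p in D) ((z == p.1)%:R * Z p.1 p.2
      + (z == p.2)%:R * Z p.2 p.1)).
    rewrite [RHS]big_enum_val /=; apply: eq_bigr => r _; rewrite !mxE -/z.
    by rewrite [Z (enum_val r).2 _]Zanti; ring.
  rewrite -(@sum_arcs (fun p => (z == p.1)%:R * Z p.1 p.2)) => [|x y /Z0 /= ->].
    rewrite (bigD1 z) //= [X in _ + X]big1 ?addr0 => [|x /negPf xz]; last first.
      by rewrite big1 // => y _; rewrite eq_sym xz mul0r.
    by rewrite -[RHS](Zsum z); apply: eq_bigr => y _; rewrite eqxx mul1r.
  by rewrite mulr0.
have rankB : \rank B = #|V|.
  rewrite -mxrank_tr; apply/eqP; apply: inj_row_free => v vB.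
  pose f x := v 0 (enum_rank x).
  have fE x y : a x y != 0 -> f x = (a x y)%:~R * f y.
    wlog xy : x y / (enum_rank x < enum_rank y)%N => [hw axy|axy].
      have [|yx|exy] := ltngtP (enum_rank x) (enum_rank y).
        by move=> lt; apply: hw.
        have yx0 : a y x != 0 by rewrite adjC.
        by rewrite (hw y x) // (a_sym x y) mulrA -intrM -expr2 a_sqr yx0 mul1r.
      by move: axy; rewrite (enum_rank_inj (val_inj exy)) a_irr eqxx.
    have pD : (x, y) \in D by rewrite !inE /= axy xy.
    have := congr1 (fun w : 'rV_#|D| => w 0 (enum_rank_in pD (x, y))) vB.
    rewrite !mxE => /eqP.
    rewrite (eq_bigr (fun c => v 0 c * (enum_val c == x)%:R
        - (a x y)%:~R * (v 0 c * (enum_val c == y)%:R))); last first.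
      by move=> c _; rewrite !mxE enum_rankK_in //=; ring.
    have pick (w : V) : \sum_c v 0 c * (enum_val c == w)%:R = f w.
      rewrite (bigD1 (enum_rank w)) //= enum_rankK eqxx mulr1 big1 ?addr0 // => c.
      move=> cw; rewrite (_ : (_ == w) = false) ?mulr0 //.
      by apply: contraNF cw => /eqP <-; rewrite enum_valK.
    by rewrite sumrB -big_distrr /= !pick subr_eq0 => /eqP.
  have f0 := unpotential fE.
  by apply/rowP => c; rewrite mxE -(f0 (enum_val c)) /f enum_valK.
move=> cY cY' [x0 [y0 Y0]].
have vecY0 : vec Y != 0.
  have [Yanti YZ _] := cY.
  wlog xy : x0 y0 Y0 / (enum_rank x0 < enum_rank y0)%N => [hw|].
    have [|yx|exy] := ltngtP (enum_rank x0) (enum_rank y0); first exact: (hw _ _ Y0).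
      apply: (hw y0 x0) => //; rewrite Yanti oppr_eq0 mulf_neq0 // intr_eq0.
      by apply: contraNneq Y0 => /YZ ->.
    by move: Y0; rewrite (enum_rank_inj (val_inj exy)) YZ ?a_irr ?eqxx.
  have pD : (x0, y0) \in D.
    by rewrite !inE /= xy andbT; apply: contraNneq Y0 => /YZ ->.
  apply: contraNneq Y0 => /rowP/(_ (enum_rank_in pD (x0, y0))).
  by rewrite !mxE enum_rankK_in //= => ->.
have ker1 : \rank (kermx B) = 1%N by rewrite mxrank_ker rankB cardD subSnn.
have subY : (vec Y <= kermx B)%MS by apply/sub_kermxP/vecB.
have kerY : (kermx B <= vec Y)%MS.
  by rewrite -(geq_leqif (mxrank_leqif_sup subY)) ker1 rank_rV vecY0.
have /sub_rVP[c cE] : (vec Y' <= vec Y)%MS.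
  by apply: submx_trans kerY; apply/sub_kermxP/vecB.
have onD x y : (x, y) \in D -> Y' x y = c * Y x y.
  move=> pD; move/rowP/(_ (enum_rank_in pD (x, y))): cE.
  by rewrite !mxE enum_rankK_in.
exists c => x y; have [Yanti YZ _] := cY; have [Yanti' YZ' _] := cY'.
have [axy|axy] := eqVneq (a x y) 0; first by rewrite YZ // YZ' // mulr0.
have [xy|yx|exy] := ltngtP (enum_rank x) (enum_rank y).
- by apply: onD; rewrite !inE /= axy.
- by rewrite Yanti Yanti' onD ?inE /= ?inE /= 1?adjC ?axy //; ring.
- by move: axy; rewrite (enum_rank_inj (val_inj exy)) a_irr eqxx.
Qed.

(* Going round a positive 4-cycle i-k-j-l, with weights obtained by carrying 1
   along the edge signs. *)
Let around i j k l x y : rat :=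
  let d p q := ((x == p) && (y == q))%:R in
  let: (s1, s2, s3) := ((a i k)%:~R, (a k j)%:~R, (a j l)%:~R) in
  d i k - s1 * d k i + s1 * d k j - s1 * s2 * d j k
  + s1 * s2 * d j l - s1 * s2 * s3 * d l j + s1 * s2 * s3 * d l i - d i l.

(** The vertex sums cancel in pairs whatever the signs are; positivity enters at the closing edge
    l-i, where the carried weight has to return to 1. *)
Let around_circulation i j k l : a i k * a k j * a j l * a l i = 1 ->
  circulation (around i j k l).
Proof.
move=> prod1.
have : a i k * a k j * a j l * a l i != 0 by rewrite prod1.
rewrite !mulf_eq0 !negb_or -!andbA => /and4P[ik kj jl li].
have sq (x y : V) : a x y != 0 -> a x y = 1 \/ a x y = -1.
  by move=> xy; apply/pred2P; rewrite /= -sqrf_eq1 a_sqr xy.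
have [ki jk lj il] : [/\ a k i = a i k, a j k = a k j, a l j = a j l & a i l = a l i].
  by split; apply: a_sym.
split=> [x y|x y xy0|x].
- pose d p q : rat := ((x == p) && (y == q))%:R.
  have ad p q : (a x y)%:~R * d p q = (a p q)%:~R * d p q.
    by rewrite /d; case: eqP => [->|_]; case: eqP => [->|_]; rewrite ?mulr0.
  rewrite /around !(andbC (y == _)) -/(d i k) -/(d k i) -/(d k j) -/(d j k).
  rewrite -/(d j l) -/(d l j) -/(d l i) -/(d i l).
  transitivity (- ((a x y)%:~R * d i k - (a i k)%:~R * ((a x y)%:~R * d k i)
    + (a i k)%:~R * ((a x y)%:~R * d k j)
    - (a i k)%:~R * (a k j)%:~R * ((a x y)%:~R * d j k)
    + (a i k)%:~R * (a k j)%:~R * ((a x y)%:~R * d j l)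
    - (a i k)%:~R * (a k j)%:~R * (a j l)%:~R * ((a x y)%:~R * d l j)
    + (a i k)%:~R * (a k j)%:~R * (a j l)%:~R * ((a x y)%:~R * d l i)
    - (a x y)%:~R * d i l)); last by ring.
  rewrite !ad ki jk lj il; move: prod1.
  case: (sq _ _ ik) => ->; case: (sq _ _ kj) => ->; case: (sq _ _ jl) => ->;
    case: (sq _ _ li) => -> // _; ring.
- have d0 p q : a p q != 0 -> (x == p) && (y == q) = false.
    by move=> pq; apply: contraNF pq => /andP[/eqP<- /eqP<-]; rewrite xy0.
  by rewrite /around !d0 ?ki ?jk ?lj ?il //; ring.
- have sum_d p q : \sum_y ((x == p) && (y == q))%:R = (x == p)%:R :> rat.
    rewrite (bigD1 q) //= eqxx andbT big1 ?addr0 // => y /negPf ->.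
    by rewrite andbF.
  rewrite /around !(sumrB, big_split) /= -!big_distrr /= !sum_d.
  by ring.
Qed.

Let around_support i j k l x y : around i j k l x y != 0 ->
  (x \in [:: i; j]) && (y \in [:: k; l]) || (x \in [:: k; l]) && (y \in [:: i; j]).
Proof.
apply: contraR; rewrite !inE /around; case: (x == i); case: (x == j);
  case: (x == k); case: (x == l); case: (y == i); case: (y == j);
  case: (y == k); case: (y == l) => //= _; by rewrite ?mulr0 ?subr0 ?addr0.
Qed.

(* The cycle space of an unbalanced bicyclic signed graph is a line, so all
   positive 4-cycles have the same edges; each is counted eight times. *)
Lemma quad_le8 X : quad X <= 8.
Proof.
have distinct i j k l : i != j -> k != l -> a i k * a k j * a j l * a l i = 1 ->
    [/\ i != k, i != l, j != k & j != l].
  move=> ij kl prod1; have : a i k * a k j * a j l * a l i != 0 by rewrite prod1.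
  rewrite !mulf_eq0 !negb_or -!andbA => /and4P[ik kj jl li].
  by rewrite (adj_neq ik) (eq_sym i) (adj_neq li) (eq_sym j k) (adj_neq kj)
     (adj_neq jl).
have around_neq0 i j k l : i != j -> k != l ->
    a i k * a k j * a j l * a l i = 1 ->
    [/\ around i j k l i k != 0, around i j k l k j != 0,
        around i j k l j l != 0 & around i j k l l i != 0].
  move=> ij kl prod1; have [ik il jk jl] := distinct _ _ _ _ ij kl prod1.
  have : a i k * a k j * a j l * a l i != 0 by rewrite prod1.
  rewrite !mulf_eq0 !negb_or -!andbA => /and4P[s1 s2 s3 s4].
  have ne x y : x != y -> (y == x = false) * (x == y = false).
    by move=> /negPf xy; rewrite eq_sym xy.
  rewrite /around !eqxx !(ne _ _ ik, ne _ _ ij, ne _ _ il, ne _ _ kl, ne _ _ jk,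
    ne _ _ jl) /=.
  rewrite !(mulr0, mulr1, subr0, addr0, add0r, sub0r).
  by split; rewrite ?mulf_neq0 ?intr_eq0.
(* Every term is at most 1 and is positive only for a positive 4-cycle, so a list containing all of
   these bounds the sum; negative cycles only lower it. *)
have term_le (L : seq (V * V * V * V)) :
    (forall i j k l, i != j -> k != l -> a i k * a k j * a j l * a l i = 1 ->
       (i, j, k, l) \in L) -> (size L <= 8)%N -> quad X <= 8.
  move=> inL sL; rewrite /quad !pair_big_dep /=.
  apply: (@le_trans _ _ #|L|%:Z); last by apply: leq_trans (card_size L) sL.
  rewrite -sum1_card Posz_sum big_mkcond [leRHS]big_mkcond /=.
  apply: ler_sum => -[[[i j] k] l] _ /=.
  case: ifP => _; last by case: ifP.
  rewrite /quad_term; case: ifP => [/andP[ij kl]|_]; last by case: ifP.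
  have sgn x y : [|| a x y == 0, a x y == 1 | a x y == -1].
    by have [//|xy] := eqVneq (a x y) 0; rewrite -sqrf_eq1 a_sqr xy.
  have := inL i j k l ij kl; move: (sgn i k) (sgn k j) (sgn j l) (sgn l i).
  case/or3P=> /eqP-> /or3P[] /eqP-> /or3P[] /eqP-> /or3P[] /eqP->;
    by [case: ifP | move=> /(_ erefl) ->].
pose pos (t : V * V * V * V) := let: (i, j, k, l) := t in
  [&& i != j, k != l & a i k * a k j * a j l * a l i == 1].
have [[[[i j] k] l] /= /and3P[ij kl /eqP prod1]|none] := pickP pos; last first.
  apply: (term_le [::]) => // i j k l ij kl prod1.
  by have := none (i, j, k, l); rewrite /= ij kl prod1 eqxx.
have [ik il jk jl] := distinct _ _ _ _ ij kl prod1.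
apply: (term_le [:: (i, j, k, l); (i, j, l, k); (j, i, k, l); (j, i, l, k);
                    (k, l, i, j); (k, l, j, i); (l, k, i, j); (l, k, j, i)]) => //.
move=> i' j' k' l' ij' kl' prod1'.
have [nz _ _ _] := around_neq0 _ _ _ _ ij kl prod1.
have [c cE] := circulation_unique (around_circulation prod1)
  (around_circulation prod1') (ex_intro _ i (ex_intro _ k nz)).
(* Proportional circulations have nested supports: every edge of the second cycle joins {i, j} to
   {k, l}. Hence the second cycle is one of the eight traversals of the first. *)
have supp x y : around i' j' k' l' x y != 0 ->
    (x \in [:: i; j]) && (y \in [:: k; l])
    || (x \in [:: k; l]) && (y \in [:: i; j]).
  by rewrite cE mulf_eq0 negb_or => /andP[_]; apply: around_support.
have [] := around_neq0 _ _ _ _ ij' kl' prod1'.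
move=> /supp e1 /supp e2 /supp e3 /supp e4.
have sep x : x \in [:: i; j] -> x \in [:: k; l] -> False.
  by rewrite !inE => /orP[] /eqP-> /orP[]; apply/negP.
have two x y p q : x \in [:: p; q] -> y \in [:: p; q] -> x != y ->
    x = p /\ y = q \/ x = q /\ y = p.
  rewrite !inE => /orP[] /eqP-> /orP[] /eqP->; rewrite ?eqxx //; tauto.
have [[iI jI kK lK]|[iK jK kI lI]] :
    [/\ i' \in [:: i; j], j' \in [:: i; j], k' \in [:: k; l] & l' \in [:: k; l]]
    \/ [/\ i' \in [:: k; l], j' \in [:: k; l], k' \in [:: i; j]
        & l' \in [:: i; j]].
  case/orP: e1 => /andP[iI kK].
    case/orP: e2 => /andP[kI jI]; first by case: (sep k').
    by case/orP: e3 => /andP[jI' lK]; [left | case: (sep j')].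
  case/orP: e2 => /andP[kI jI]; last by case: (sep k').
  by case/orP: e3 => /andP[jI' lK]; [case: (sep j') | right].
have [[-> ->]|[-> ->]] := two _ _ _ _ iI jI ij';
  have [[-> ->]|[-> ->]] := two _ _ _ _ kK lK kl';
  by rewrite !inE !xpair_eqE !eqxx /= ?orbT.
have [[-> ->]|[-> ->]] := two _ _ _ _ iK jK ij';
  have [[-> ->]|[-> ->]] := two _ _ _ _ kI lI kl';
  by rewrite !inE !xpair_eqE !eqxx /= ?orbT.
Qed.

End Circulations.

End SignedAdjacency.

(** * Signed graphs as sign functions on pairs of vertices *)

Definition signed_adj n (G : sgraph n) (x y : 'I_n) : int :=
  if [set x; y] \in edges G then sigma G [set x; y] else 0.

Section SignedGraphAdjacency.
Variables (n : nat) (G : sgraph n).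
Let a := signed_adj G.

Lemma signed_adj_sym x y : a x y = a y x.
Proof. by rewrite /a /signed_adj setUC. Qed.

Lemma signed_adj_irr x : a x x = 0.
Proof.
rewrite /a /signed_adj; case: ifP => // /edges_card2.
by rewrite setUid cards1.
Qed.

Lemma signed_adj_neq0 x y : (a x y != 0) = ([set x; y] \in edges G).
Proof.
rewrite /a /signed_adj; case: ifP => [/sigma_sign[]->|_] //; by rewrite eqxx.
Qed.

Lemma signed_adj_sqr x y : a x y ^+ 2 = (a x y != 0)%:R.
Proof.
rewrite signed_adj_neq0 /a /signed_adj; case: ifP => [/sigma_sign[]->|_] //.
Qed.

Lemma card_signed_arcs : #|arcs a [set: 'I_n]| = (2 * #|edges G|)%N.
Proof.
pose e (p : 'I_n * 'I_n) := [set p.1; p.2].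
have memE p : (p \in arcs a setT) = (e p \in edges G).
  by rewrite inE !in_setT /= signed_adj_neq0.
rewrite -sum1_card (partition_big e (fun f => f \in edges G)) => [|p]; last first.
  by rewrite memE.
rewrite mulnC -sum_nat_const /=; apply: eq_bigr => f fG.
have /eqP/cards2P[x [y [xy fE]]] := edges_card2 fG.
rewrite sum1_card; transitivity #|[set (x, y); (y, x)]|; last first.
  by rewrite cards2 xpair_eqE (negPf xy).
apply: eq_card => -[p q]; rewrite !inE unfold_in /= -/(e (p, q)) memE.
rewrite !xpair_eqE; apply/andP/orP => [[_ /eqP]|[]/andP[/eqP-> /eqP->]].
- rewrite /e /= fE => pqE.
  have : p \in [set x; y] by rewrite -pqE !inE eqxx.
  have : q \in [set x; y] by rewrite -pqE !inE eqxx orbT.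
  have : x \in [set p; q] by rewrite pqE !inE eqxx.
  have : y \in [set p; q] by rewrite pqE !inE eqxx orbT.
  rewrite !inE => /orP[]/eqP yE /orP[]/eqP xE /orP[]/eqP qE /orP[]/eqP pE;
    by move: xy; rewrite ?eqxx; subst; rewrite ?eqxx //; auto.
- by rewrite /e /= -fE.
- by rewrite /e /= setUC -fE.
Qed.

Lemma sum_signed_deg :
  (\sum_(x in [set: 'I_n]) deg a setT x = 2 * #|edges G|)%N.
Proof. by rewrite -card_signed_arcs card_arcs. Qed.

Lemma connected_ind (P : pred 'I_n) : connected G ->
  (forall x y, a x y != 0 -> P x -> P y) -> forall x y, P x -> P y.
Proof.
move=> conG stepP x y Px.
have clP : closed (adj G) P.
  move=> z t; rewrite /adj -signed_adj_neq0 => zt.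
  by apply/idP/idP; apply: stepP; rewrite // signed_adj_sym.
by have := closed_connect clP (conG x y); rewrite !unfold_in Px => /esym.
Qed.

Lemma connected_cut : connected G -> cut_connected a [set: 'I_n].
Proof.
move=> conG X _ /set0Pn[x xX] XnT.
have [p /= /and3P[pX qX pq]|none] := pickP (fun p : 'I_n * 'I_n =>
  [&& p.1 \in X, p.2 \notin X & a p.1 p.2 != 0]).
  by exists p.1, p.2; rewrite in_setT.
case/negP: XnT; rewrite -subTset; apply/subsetP => y _.
apply: (@connected_ind (fun z => z \in X) conG _ _ _ xX) => z t zt zX.
apply: contraFT (none (z, t)).
by rewrite /= zX zt => ->.
Qed.

(* A nowhere zero potential would make every cycle positive. *)
Lemma unbalanced_no_potential : connected G -> unbalanced G ->
  forall f : 'I_n -> rat,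
  (forall x y, a x y != 0 -> f x = (a x y)%:~R * f y) -> forall x, f x = 0.
Proof.
move=> conG unb f fE x0; apply/eqP; apply: contra_notT unb => fx0.
(* By connectedness f^2 is constant, so the sign of an edge xy is f(x) f(y) / f(x0)^2. Since
   [next c] permutes the cycle, the product of these quotients is 1. *)
have f2 x : f x ^+ 2 = f x0 ^+ 2.
  apply/eqP; apply: (@connected_ind [pred x | f x ^+ 2 == f x0 ^+ 2] conG _ x0).
    move=> y z yz /= /eqP <-; rewrite (fE _ _ yz) exprMn -rmorphXn /=.
    by rewrite signed_adj_sqr yz mul1r.
  by rewrite /=.
move=> c [_ /andP[cyc uc]]; apply/eqP; rewrite -(eqr_int rat).
rewrite /cycle_sign rmorph_prod /=.
rewrite big_seq (eq_bigr (fun x => f x * f (next c x) / f x0 ^+ 2)); last first.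
  move=> x xc; have := next_cycle cyc xc; rewrite /adj => e.
  have xE : a x (next c x) = sigma G [set x; next c x] by rewrite /a /signed_adj e.
  have nz : a x (next c x) != 0 by rewrite signed_adj_neq0.
  by rewrite (fE _ _ nz) xE -[_ * f _ * f _]mulrA -expr2 f2 mulfK // expf_neq0.
rewrite -big_seq rmorph1; apply/eqP.
transitivity (\prod_(x <- c) (f x * (f x0 ^+ 2)^-1) * \prod_(x <- c) f (next c x)).
  by rewrite -big_split; apply: eq_bigr => x _ /=; ring.
have -> : \prod_(x <- c) f (next c x) = \prod_(x <- c) f x.
  rewrite -(big_map (next c) xpredT f); apply: perm_big.
  apply: uniq_perm; rewrite ?map_inj_uniq //; first exact: can_inj (prev_next uc).
  move=> x; apply/mapP/idP => [[y yc ->]|xc]; first by rewrite mem_next.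
  by exists (prev c x); rewrite ?mem_prev ?next_prev.
rewrite -big_split /= big1 // => x _.
by rewrite mulrAC -expr2 f2 mulfV // expf_neq0.
Qed.
End SignedGraphAdjacency.

(** * Spectral moments and the Estrada index *)

Section EstradaBounds.
Variables (R : realType) (n : nat) (G : sgraph n).
Let a := signed_adj G.
Let A := adjmx R G.
Let a_sym : forall x y, a x y = a y x := @signed_adj_sym n G.
Let a_irr : forall x, a x x = 0 := @signed_adj_irr n G.

Lemma adjmxE i j : A i j = (a i j)%:~R.
Proof. by rewrite mxE /a /signed_adj; case: ifP. Qed.

Lemma signed_spectrum : exists rs : seq R,
  [/\ forall c, char_poly (c *: A) = \prod_(r <- rs) ('X - (c * r)%:P),
      perm_eq (eigenvalues A) rs, size rs = n
    & [/\ \sum_(r <- rs) r = 0, \sum_(r <- rs) r ^+ 2 = (2 * #|edges G|)%:R,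
          \sum_(r <- rs) r ^+ 3 = (tri a setT)%:~R
        & \sum_(r <- rs) r ^+ 4 = (weight a setT)%:~R - (2 * #|edges G|)%:R]].
Proof.
have sumT (T : nmodType) (F : 'I_n -> T) : \sum_(i in [set: 'I_n]) F i = \sum_i F i.
  by apply: eq_bigl => i; rewrite in_setT.
have natZ N : N%:R = N%:Z%:~R :> R by rewrite -pmulrn.
have Asym : A^T = A by apply/matrixP=> i j; rewrite [LHS]mxE !adjmxE a_sym.
have [rs [size_rs cp tr]] := symmetric_spectrum Asym.
exists rs; split=> //.
  apply: perm_eigenvalues; rewrite -[A]scale1r cp.
  by apply: eq_bigr => r _; rewrite mul1r.
have mulAA i j : (A *m A) i j = (\sum_k a i k * a k j)%:~R.
  by rewrite mxE rmorph_sum; apply: eq_bigr => k _; rewrite !adjmxE rmorphM.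
split.
- have := tr 1%N; rewrite /= mulmx1 => trE.
  rewrite -[LHS](_ : \sum_(r <- rs) r ^+ 1 = _) // -trE /mxtrace big1 // => i _.
  by rewrite adjmxE a_irr.
- rewrite -(tr 2%N) /= mulmx1 -sum_signed_deg natZ Posz_sum rmorph_sum sumT.
  apply: eq_bigr => i _; rewrite (degE (signed_adj_sqr G)) sumT mulAA.
  by congr _%:~R; apply: eq_bigr => k _; rewrite expr2 [a k i]a_sym.
- rewrite -(tr 3%N) /= mulmx1 /tri sumT rmorph_sum; apply: eq_bigr => i _.
  rewrite mxE sumT rmorph_sum; apply: eq_bigr => j _.
  rewrite sumT adjmxE mulAA -rmorphM big_distrr /=; congr _%:~R.
  by apply: eq_bigr => k _; rewrite mulrA.
rewrite -(tr 4%N) /= mulmx1 !mulmxA -mulmxA -!mulmxA mulmxA.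
have := sum_walk2_sqr (signed_adj_sym G) (signed_adj_sqr G) setT.
rewrite sum_signed_deg -/a => walk.
have -> : weight a setT = \sum_(i in [set: 'I_n]) \sum_(j in [set: 'I_n])
    (\sum_(k in [set: 'I_n]) a i k * a k j) ^+ 2 + (2 * #|edges G|)%N%:Z.
  by rewrite walk /weight; ring.
rewrite rmorphD /= natZ addrK sumT rmorph_sum; apply: eq_bigr => i _.
rewrite mxE sumT rmorph_sum; apply: eq_bigr => j _.
rewrite !mulAA -rmorphM expr2 sumT; congr (_ * _)%:~R.
by apply: eq_bigr => k _; rewrite [a j k]a_sym [a k i]a_sym mulrC.
Qed.

(** Summed over a spectrum with vanishing first and third moments, the subtracted cubic depends only
    on the numbers of vertices and edges. Unlike [cosh_tail], it needs no pairing of eigenvalues. *)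
Definition cubic_tail (x : R) := expR x - (1 + x + x ^+ 2 / 2 + x ^+ 3 / 6).

Lemma estrada_cubic_tail rs : perm_eq (eigenvalues A) rs ->
  size rs = n -> \sum_(r <- rs) r = 0 -> \sum_(r <- rs) r ^+ 3 = 0 ->
  \sum_(r <- rs) r ^+ 2 = (2 * #|edges G|)%:R ->
  estrada R G = n%:R + #|edges G|%:R + \sum_(r <- rs) cubic_tail r.
Proof.
move=> permrs size_rs s1 s3 s2; rewrite /estrada (perm_big _ permrs) /=.
have : \sum_(r <- rs) (1 + r + r ^+ 2 / 2 + r ^+ 3 / 6) = n%:R + #|edges G|%:R :> R.
  rewrite !big_split /= -!mulr_suml s1 s2 s3 mul0r !addr0.
  by rewrite big_const_seq count_predT iter_addr addr0 size_rs natrM; field.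
by move=> <-; rewrite -big_split; apply: eq_bigr => r _; rewrite /= addrC subrK.
Qed.

Lemma sum_uniq_le (rs s : seq R) (F : R -> R) : (forall x, 0 <= F x) ->
  uniq s -> {subset s <= rs} -> \sum_(x <- s) F x <= \sum_(x <- rs) F x.
Proof.
move=> F0; elim: s rs => [|x s IH] rs /=; first by rewrite big_nil sumr_ge0.
move=> /andP[xs us] sub; rewrite big_cons.
have xrs : x \in rs by apply: sub; rewrite mem_head.
rewrite (perm_big _ (perm_to_rem xrs)) big_cons lerD2l; apply: IH => // y ys.
have yx : y != x by apply: contraNneq xs => <-.
have := sub y; rewrite inE ys orbT (perm_mem (perm_to_rem xrs)) inE (negPf yx).
by apply.
Qed.

Lemma cubic_tailD x : cubic_tail x + cubic_tail (- x) = cosh_tail x.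
Proof. by rewrite /cubic_tail /cosh_tail; field. Qed.

Lemma cubic_tail_ge0 x : 0 <= cubic_tail x.
Proof. by rewrite subr_ge0 expR_ge_cubic. Qed.

Section Spectrum.
Variable rs : seq R.
Hypothesis permrs : perm_eq (eigenvalues A) rs.
Hypothesis size_rs : size rs = n.
Hypothesis s2 : \sum_(r <- rs) r ^+ 2 = (2 * #|edges G|)%:R.

(** Symmetry makes the sum of [cubic_tail] half that of [cosh_tail]. By [cosh_tail_quartic] each
    psi(r) is at most r^4 psi(T) / T^4, so the psi(r) sum to at most 2 psi(T). *)
Lemma estrada_le T : perm_eq rs (map -%R rs) -> (0 < #|edges G|)%N -> 0 <= T ->
  \sum_(r <- rs) r ^+ 4 <= 2 * T ^+ 4 ->
  estrada R G <= n%:R + #|edges G|%:R + cosh_tail T.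
Proof.
move=> sym e0 T0 s4.
have sumN (F : R -> R) : \sum_(r <- rs) F (- r) = \sum_(r <- rs) F r.
  by rewrite [RHS](perm_big _ sym) big_map.
have odd0 k : \sum_(r <- rs) r ^+ k.*2.+1 = 0.
  suff : \sum_(r <- rs) r ^+ k.*2.+1 = - \sum_(r <- rs) r ^+ k.*2.+1 by lra.
  rewrite -[LHS](sumN (fun r => r ^+ k.*2.+1)) -sumrN; apply: eq_bigr => r _.
  by rewrite exprNn -signr_odd /= odd_double expr1 mulN1r.
have s1 : \sum_(r <- rs) r = 0.
  by rewrite -[RHS](odd0 0%N); apply: eq_bigr => r _; rewrite expr1.
rewrite (estrada_cubic_tail permrs size_rs s1 (odd0 1%N) s2) lerD2l.
have tail2 : 2 * \sum_(r <- rs) cubic_tail r = \sum_(r <- rs) cosh_tail r.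
  rewrite mulr_natl mulr2n -[X in _ + X](sumN cubic_tail) -big_split /=.
  by apply: eq_bigr => r _; rewrite cubic_tailD.
have bound r : r \in rs -> `|r| <= T.
  move=> rrs; have [->|r0] := eqVneq r 0; first by rewrite normr0.
  rewrite -(@ler_pXn2r _ 4) ?nnegrE // -(ler_pM2l (ltr0n R 2)).
  apply: le_trans s4; have : uniq [:: r; - r].
    by rewrite /= inE eq_sym eqNr r0.
  move=> /(@sum_uniq_le rs _ (fun x => x ^+ 4) (fun x => _)).
  rewrite !big_cons big_nil addr0 exprNn -signr_odd mul1r -normrX.
  rewrite ger0_norm ?exprn_even_ge0 // mulr_natl mulr2n; apply.
    by move=> x; rewrite exprn_even_ge0.
  move=> x; rewrite !inE => /orP[]/eqP-> //.
  by rewrite (perm_mem sym) map_f.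
have Tpos : 0 < T.
  rewrite lt_neqAle T0 andbT; apply/eqP => T0'.
  have : \sum_(r <- rs) r ^+ 2 = 0.
    rewrite big_seq big1 // => r /bound; rewrite -T0' normr_le0 => /eqP ->.
    by rewrite expr0n.
  by move/eqP; rewrite s2 pnatr_eq0 muln_eq0 /= eqn0Ngt e0.
have T4 : 0 < T ^+ 4 by rewrite exprn_gt0.
rewrite -(ler_pM2l (ltr0n R 2)) tail2 -(ler_pM2l T4).
apply: (@le_trans _ _ ((\sum_(r <- rs) r ^+ 4) * cosh_tail T)).
  rewrite mulr_sumr mulr_suml big_seq [leRHS]big_seq.
  by apply: ler_sum => r /bound; apply: cosh_tail_quartic.
apply: le_trans (ler_wpM2r (cosh_tail_ge0 T) s4) _.
by rewrite [leLHS](_ : _ = T ^+ 4 * (2 * cosh_tail T)) //; ring.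
Qed.

Lemma estrada_ge (s : seq R) : \sum_(r <- rs) r = 0 ->
  \sum_(r <- rs) r ^+ 3 = 0 -> uniq s -> {subset s <= rs} ->
  n%:R + #|edges G|%:R + \sum_(r <- s) cubic_tail r <= estrada R G.
Proof.
move=> s1 s3 us sub; rewrite (estrada_cubic_tail permrs size_rs s1 s3 s2).
by rewrite lerD2l; apply: sum_uniq_le => //; apply: cubic_tail_ge0.
Qed.

End Spectrum.

Lemma estrada_lower (s : seq R) : tri a setT = 0 -> uniq s ->
  (forall mu, mu \in s -> eigenvalue A mu) ->
  n%:R + #|edges G|%:R + \sum_(r <- s) cubic_tail r <= estrada R G.
Proof.
move=> tri0 us eigs.
have [rs [cp permrs size_rs [s1 s2 s3 _]]] := signed_spectrum.
apply: (estrada_ge permrs) => //; first by rewrite s3 tri0.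
move=> mu /eigs; rewrite eigenvalue_root_char -[A]scale1r cp.
by under eq_bigr => r _ do rewrite mul1r; rewrite root_prod_XsubC.
Qed.

Lemma pairing_symmetric (rs : seq R) :
  char_poly A = \prod_(r <- rs) ('X - r%:P) -> pairing R G ->
  perm_eq rs (map -%R rs).
Proof.
move=> cp pair; have mult mu : eig_mult A mu = count_mem mu rs.
  by rewrite /eig_mult cp mu_prod_XsubC.
have eig mu : eigenvalue A mu = (mu \in rs).
  by rewrite eigenvalue_root_char cp root_prod_XsubC.
have countN mu : count_mem (- mu) rs = count_mem mu rs.
  have [murs|murs] := boolP (mu \in rs).
    by have [|_] := pair mu; rewrite -/A ?eig // !mult.
  rewrite (count_memPn murs); apply/count_memPn; apply: contra murs => Nmurs.
  (* [pairing] speaks of eigenvalues only; if [mu] is not one, it is applied to [- mu]. *)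
  by have [|] := pair (- mu); rewrite -/A ?eig // opprK.
apply/allP => x _ /=; apply/eqP; rewrite count_map -countN.
by apply: eq_count => y /=; rewrite eqr_oppLR.
Qed.

Lemma skew_symmetric (rs : seq R) :
  (forall c, char_poly (c *: A) = \prod_(r <- rs) ('X - (c * r)%:P)) ->
  char_poly (- A) = char_poly A -> perm_eq rs (map -%R rs).
Proof.
move=> cp; rewrite -scaleN1r -[in RHS](scale1r A) !cp => cpE.
apply/allP => x _ /=; apply/eqP.
have := congr1 (mup x) cpE.
rewrite -(big_map (fun r => -1 * r) xpredT (fun r => 'X - r%:P)).
rewrite -(big_map (fun r => 1 * r) xpredT (fun r => 'X - r%:P)) !mu_prod_XsubC.
rewrite (eq_map (fun r => mul1r r)) map_id => <-; congr (count_mem x _).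
by apply: eq_map => r; rewrite mulN1r.
Qed.

End EstradaBounds.

(** * Stars with two additional edges *)

Section StarSpectrum.
Variables (n : nat) (G : sgraph n) (u x1 y1 x2 y2 : 'I_n).
Let a := signed_adj G.
Let R := [set: 'I_n] :\ u.
Let a_sym : forall x y, a x y = a y x := @signed_adj_sym n G.
Let a_irr : forall x, a x x = 0 := @signed_adj_irr n G.
Let a_sqr : forall x y, a x y ^+ 2 = (a x y != 0)%:R := @signed_adj_sqr n G.
Hypothesis star : forall x, x != u -> a u x != 0.
Hypothesis edgesR : two_edges a R x1 y1 x2 y2.

Let inR x : (x \in R) = (x != u).
Proof. by rewrite !inE andbT. Qed.

Let rim : [/\ x1 != u, y1 != u, x2 != u & y2 != u].
Proof. by have [] := two_edges_mem edgesR; rewrite !inR. Qed.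

(** Writing both alternatives of [two_edges] with indicators lets eigenvector equations and
    isomorphisms be checked uniformly. *)
Lemma tri_sign_rim x y : x != u -> y != u -> tri_sign a u x y =
  tri_sign a u x1 y1 * (((x == x1) && (y == y1))%:R + ((x == y1) && (y == x1))%:R)
  + tri_sign a u x2 y2
    * (((x == x2) && (y == y2))%:R + ((x == y2) && (y == x2))%:R).
Proof.
move=> xu yu; case: (edgesR) => arcsR hu.
have := two_edges_uniq hu; rewrite /= !inE !negb_or !xpair_eqE.
have := mem_arcs a (S := R) (x := x) (y := y); rewrite !inR => /(_ xu yu).
rewrite arcsR !inE !xpair_eqE -!orbA.
have [/andP[/eqP-> /eqP->]|n1] := boolP ((x == x1) && (y == y1)).
  move=> _ /and3P[/and3P[/negPf-> /negPf-> /negPf->] _ _].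
  by rewrite /=; ring.
have [/andP[/eqP-> /eqP->]|n2] := boolP ((x == y1) && (y == x1)).
  move=> _ /and3P[_ /andP[/negPf-> /negPf->] _].
  by rewrite (tri_signC a_sym) /=; ring.
have [/andP[/eqP-> /eqP->]|n3] := boolP ((x == x2) && (y == y2)).
  move=> _ /and3P[_ _ /andP[/negPf-> _]].
  by rewrite /=; ring.
have [/andP[/eqP-> /eqP->]|n4] := boolP ((x == y2) && (y == x2)).
  by move=> _ _; rewrite (tri_signC a_sym) /=; ring.
move=> /esym/negbT/negPn/eqP xy0 _.
by rewrite /tri_sign xy0 /=; ring.
Qed.

Lemma tri_star_setT : tri a setT = 6 * (tri_sign a u x1 y1 + tri_sign a u x2 y2).
Proof. exact: (tri_star a_sym a_irr (in_setT u) edgesR). Qed.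

Lemma card_edges_star : #|edges G| = n.+1.
Proof.
have := sum_deg_star a_sym a_irr a_sqr (in_setT u) (fun x _ => @star x) edgesR.
by rewrite sum_signed_deg cardsT card_ord => /eqP; rewrite eqn_mul2l => /eqP.
Qed.

Section Eigenvector.
Variable F : realType.
Let A := adjmx F G.

(* [U] and [a u w * X w] are the entries of an eigenvector at [u] and at [w]. *)
Lemma star_eigenvalue (mu U : F) (X : 'I_n -> F) :
  (forall z, z != u ->
     U + \sum_(w | w != u) (tri_sign a u z w)%:~R * X w = mu * X z) ->
  \sum_(w | w != u) X w = mu * U ->
  (exists2 z, z != u & X z != 0) -> eigenvalue A mu.
Proof.
move=> rimE centreE [z0 z0u Xz0].
have sq w : w != u -> (a u w)%:~R * (a u w)%:~R = 1 :> F.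
  by move=> /star uw; rewrite -rmorphM -expr2 a_sqr uw.
pose v : 'rV[F]_n := \row_w if w == u then U else (a u w)%:~R * X w.
have vE w : v 0 w = if w == u then U else (a u w)%:~R * X w by rewrite mxE.
apply/eigenvalueP; exists v; last first.
  apply: contraNneq Xz0 => /rowP/(_ z0); rewrite !mxE (negPf z0u) => /eqP.
  by rewrite mulf_eq0 intr_eq0 (negPf (star z0u)).
apply/rowP => z; rewrite [RHS]mxE vE [LHS]mxE (bigD1 u) //= vE eqxx adjmxE.
rewrite -/a (eq_bigr (fun w => (a u w)%:~R * (a w z)%:~R * X w)); last first.
  by move=> w wu; rewrite vE (negPf wu) adjmxE -/a; ring.
have [->|zu] := eqVneq z u.
  rewrite a_irr mulr0 add0r -centreE; apply: eq_bigr => w wu.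
  by rewrite (a_sym w u) sq // mul1r.
rewrite mulrCA -rimE // mulrDr mulr_sumr mulrC; congr (_ + _).
apply: eq_bigr => w wu; rewrite /tri_sign !rmorphM /= (a_sym w u) (a_sym z w).
by rewrite !mulrA sq // mul1r; ring.
Qed.

Hypothesis tau1 : tri_sign a u x1 y1 = 1.
Hypothesis tau2 : tri_sign a u x2 y2 = -1.

Let tri_sum (X : 'I_n -> F) z : z != u ->
  \sum_(w | w != u) (tri_sign a u z w)%:~R * X w
  = (z == x1)%:R * X y1 + (z == y1)%:R * X x1
    - (z == x2)%:R * X y2 - (z == y2)%:R * X x2.
Proof.
have [x1u y1u x2u y2u] := rim; move=> zu.
have pick p q : q != u ->
    \sum_(w | w != u) ((z == p) && (w == q))%:R * X w = (z == p)%:R * X q.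
  move=> qu; rewrite (bigD1 q) //= eqxx andbT big1 ?addr0 // => w /andP[_ /negPf->].
  by rewrite andbF mul0r.
rewrite -!pick // -big_split -!sumrB /=; apply: eq_bigr => w wu.
by rewrite tri_sign_rim // tau1 tau2; ring.
Qed.

Let sum_ind p : p != u -> \sum_(w | w != u) (w == p)%:R = 1 :> F.
Proof.
by move=> pu; rewrite (bigD1 p) //= eqxx big1 ?addr0 // => w /andP[_ /negPf->].
Qed.

Let sum_cst (c : F) : \sum_(w < n | w != u) c = (n%:R - 1) * c.
Proof.
have : \sum_(w < n) c = n%:R * c by rewrite big_const_ord iter_addr addr0 mulr_natl.
by rewrite (bigD1 u) //= mulrBl mul1r => <-; rewrite addrAC subrr add0r.
Qed.

(** With U = mu (t - 1) at the centre, the equations at the other vertices force X = t - 1 at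
    pendant vertices, mu (mu + 1) on the positive triangle and mu (mu - 1) on the negative one. The
    equation at the centre is then the quadratic in t. *)
Lemma disjoint_star_eigenvalue (mu : F) : uniq [:: x1; y1; x2; y2] ->
  let t := mu ^+ 2 in t ^+ 2 - n%:R * t + (n%:R - 5) = 0 -> mu != 0 -> mu != -1 ->
  eigenvalue A mu.
Proof.
move=> un t teq mu0 mu1; have [x1u y1u x2u y2u] := rim.
pose X w := (t - 1) + (mu + 1) * ((w == x1)%:R + (w == y1)%:R)
  + (1 - mu) * ((w == x2)%:R + (w == y2)%:R) : F.
move: un; rewrite /= !inE !negb_or -!andbA => /and5P[n1 n2 n3 n4 /and3P[n5 n6 _]].
have ne (x y : 'I_n) : x != y -> (y == x = false) * (x == y = false).
  by move=> /negPf xy; rewrite eq_sym xy.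
have ns := (ne _ _ n1, ne _ _ n2, ne _ _ n3, ne _ _ n4, ne _ _ n5, ne _ _ n6).
apply: (@star_eigenvalue mu (mu * (t - 1)) X).
- move=> z zu; rewrite tri_sum // /X !eqxx !ns.
  have [->|_] := eqVneq z x1; first by rewrite !ns /t /=; ring.
  have [->|_] := eqVneq z y1; first by rewrite !ns /t /=; ring.
  have [->|_] := eqVneq z x2; first by rewrite !ns /t /=; ring.
  by case: (z == y2); rewrite /t /=; ring.
- rewrite /X !big_split /= -!mulr_sumr !big_split /= !sum_ind // !sum_cst.
  have -> : mu * (mu * (t - 1)) = t * (t - 1) by rewrite /t /=; ring.
  apply/eqP; rewrite -subr_eq0 -oppr_eq0 -teq; apply/eqP; rewrite /t; ring.
- exists x1 => //; rewrite /X !eqxx !ns.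
  have -> : t - 1 + (mu + 1) * (1 + 0) + (1 - mu) * (0 + 0) = mu * (mu + 1).
    by rewrite /t /=; ring.
  by rewrite mulf_neq0 // addr_eq0.
Qed.

(** The entries are U = mu (t - 2) at the centre, t - 2 at pendant vertices, t at the shared vertex
    x1, and t - 2 + mu and t - 2 - mu at y1 and y2. The quadratic is again the equation at the
    centre. *)
Lemma shared_star_eigenvalue (mu : F) : x2 = x1 -> uniq [:: x1; y1; y2] ->
  let t := mu ^+ 2 in t ^+ 2 - (n%:R + 1) * t + (2 * n%:R - 4) = 0 -> mu != 0 ->
  eigenvalue A mu.
Proof.
move=> x21 un t teq mu0; have [x1u y1u x2u y2u] := rim.
pose X w := (t - 2) + 2 * (w == x1)%:R + mu * (w == y1)%:R - mu * (w == y2)%:R : F.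
move: un; rewrite /= !inE !negb_or -!andbA => /and4P[n1 n2 n3 _].
have ne (x y : 'I_n) : x != y -> (y == x = false) * (x == y = false).
  by move=> /negPf xy; rewrite eq_sym xy.
have ns := (ne _ _ n1, ne _ _ n2, ne _ _ n3).
apply: (@star_eigenvalue mu (mu * (t - 2)) X).
- move=> z zu; rewrite tri_sum // x21 /X !eqxx !ns.
  have [->|_] := eqVneq z x1; first by rewrite !ns /t /=; ring.
  have [->|_] := eqVneq z y1; first by rewrite !ns /t /=; ring.
  by case: (z == y2); rewrite /t /=; ring.
- rewrite /X !big_split /= !sumrN -!mulr_sumr !sum_ind // !sum_cst.
  have -> : mu * (mu * (t - 2)) = t * (t - 2) by rewrite /t /=; ring.
  by apply/eqP; rewrite -subr_eq0 -oppr_eq0 -teq; apply/eqP; rewrite /t; ring.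
- exists x1 => //; rewrite /X !eqxx !ns.
  have -> : t - 2 + 2 * 1 + mu * 0 - mu * 0 = mu ^+ 2 by rewrite /t /=; ring.
  by rewrite expf_neq0.
Qed.

(* Exchanging the two triangles of the shared-edge graph and switching negates
   all signs. *)
Lemma shared_star_skew : x2 = x1 -> uniq [:: x1; y1; y2] ->
  char_poly (- A) = char_poly A.
Proof.
move=> x21 un; have [x1u y1u x2u y2u] := rim.
move: un; rewrite /= !inE !negb_or -!andbA => /and4P[n1 n2 n3 _].
pose p := tperm y1 y2.
have pu : p u = u by rewrite tpermD.
have px1 : p x1 = x1 by rewrite tpermD // eq_sym.
have pn x : (p x != u) = (x != u) by rewrite -{1}pu (inj_eq perm_inj).
have triN x y : x != u -> y != u -> tri_sign a u (p x) (p y) = - tri_sign a u x y.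
  move=> xu yu; rewrite (tri_sign_rim xu yu) (@tri_sign_rim (p x) (p y)) ?pn //.
  rewrite tau1 tau2 x21.
  have e1 z : (p z == x1) = (z == x1) by rewrite -{1}px1 (inj_eq perm_inj).
  have e2 z : (p z == y1) = (z == y2) by rewrite -{1}(tpermR y1 y2) (inj_eq perm_inj).
  have e3 z : (p z == y2) = (z == y1) by rewrite -{1}(tpermL y1 y2) (inj_eq perm_inj).
  by rewrite !e1 !e2 !e3; ring.
have sq w : w != u -> a u w * a u w = 1.
  by move=> /star uw; rewrite -expr2 a_sqr uw.
(* Negating the edges at [u] forces this choice of [eps]; the remaining edges then follow from
   [triN]. *)
pose eps x : int := if x == u then 1 else - (a u x * a u (p x)).
have epsA x y : eps x * a (p x) (p y) = - (a x y * eps y).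
  rewrite /eps; have [->|xu] := eqVneq x u; have [->|yu] := eqVneq y u.
  - by rewrite pu a_irr; ring.
  - by rewrite pu mulrN opprK mulrA sq // !mul1r.
  - rewrite pu (a_sym (p x)) (a_sym x) mulNr -mulrA sq ?pn //; ring.
  have aE z w : z != u -> w != u -> a z w = a u z * a u w * tri_sign a u z w.
    move=> zu wu; rewrite /tri_sign (a_sym w u).
    transitivity ((a u z * a u z) * (a u w * a u w) * a z w); last by ring.
    by rewrite !sq // !mul1r.
  rewrite (aE (p x)) ?pn // triN // (aE x) //.
  transitivity ((a u (p x) * a u (p x)) * (a u x * a u (p y) * tri_sign a u x y));
    first by ring.
  transitivity ((a u y * a u y) * (a u x * a u (p y) * tri_sign a u x y));
    last by ring.
  by rewrite !sq ?pn.
pose P : 'M[F]_n := diag_mx (\row_i (eps i)%:~R) *m perm_mx p.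
have PE i j : P i j = (eps i)%:~R * (p i == j)%:R.
  by rewrite /P mul_diag_mx !mxE.
have Punit : P \in unitmx.
  rewrite unitmx_mul unitmx_perm andbT unitmxE det_diag unitfE.
  apply/prodf_neq0 => i _; rewrite mxE intr_eq0 /eps; case: (i =P u) => // /eqP iu.
  by rewrite oppr_eq0 mulf_neq0 ?star // pn.
symmetry; apply: (char_poly_conj Punit); apply/matrixP => i j.
rewrite [LHS]mxE [RHS]mxE.
rewrite (bigD1 (p i)) //= PE eqxx mulr1 big1 ?addr0; last first.
  by move=> k ki; rewrite PE eq_sym (negPf ki) mulr0 mul0r.
rewrite (bigD1 (p j)) //= [X in _ + X]big1 ?addr0; last first.
  move=> k kj; rewrite PE (_ : (p k == j) = false) ?mulr0 //.
  by apply: contraNF kj => /eqP <-; rewrite tpermK.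
rewrite PE tpermK eqxx mulr1 [(- A) i _]mxE !adjmxE -/a mulNr -!rmorphM -rmorphN.
by have := epsA i (p j); rewrite tpermK /= => ->.
Qed.

End Eigenvector.
End StarSpectrum.

(** * Switching equivalence of stars *)

Lemma perm_extending (T : finType) (s t : seq T) :
  uniq s -> uniq t -> size s = size t -> exists f : {perm T}, map f s = t.
Proof.
elim: s t => [|x s IH] [|y t] //=; first by exists 1%g.
move=> /andP[xs us] /andP[yt ut] [/(IH t us ut)[f fs]].
exists (f * tperm (f x) y)%g; rewrite permM tpermL; congr (_ :: _).
rewrite -fs; apply/eq_in_map => z zs; rewrite permM tpermD //.
  by rewrite (inj_eq perm_inj); apply: contraNneq xs => ->.
by apply: contraNneq yt => ->; rewrite -fs map_f.
Qed.

Lemma set2_eq (T : finType) (x y p q : T) : ([set x; y] == [set p; q]) =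
  ((x == p) && (y == q)) || ((x == q) && (y == p)).
Proof.
apply/eqP/orP => [E|[] /andP[/eqP-> /eqP->] //]; last by rewrite setUC.
have xE : x \in [set p; q] by rewrite -E !inE eqxx.
have yE : y \in [set p; q] by rewrite -E !inE eqxx orbT.
have pE : p \in [set x; y] by rewrite E !inE eqxx.
have qE : q \in [set x; y] by rewrite E !inE eqxx orbT.
move: xE yE pE qE; rewrite !inE (eq_sym p x) (eq_sym p y) (eq_sym q x) (eq_sym q y).
by case: (x == p); case: (x == q); case: (y == p); case: (y == q);
   rewrite /= ?orbT //; auto.
Qed.

(** Switching at the vertices whose edges to the centres have different signs makes those edges
    agree. The signs of the other edges are then determined by the triangle signs, which switching
    does not change. *)
Lemma star_switching_equivalent n (G H : sgraph n)
    (u x1 y1 x2 y2 u' x1' y1' x2' y2' : 'I_n) (f : {perm 'I_n}) :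
  (forall x, x != u -> signed_adj G u x != 0) ->
  two_edges (signed_adj G) (setT :\ u) x1 y1 x2 y2 ->
  (forall x, x != u' -> signed_adj H u' x != 0) ->
  two_edges (signed_adj H) (setT :\ u') x1' y1' x2' y2' ->
  [:: f u; f x1; f y1; f x2; f y2] = [:: u'; x1'; y1'; x2'; y2'] ->
  tri_sign (signed_adj G) u x1 y1 = tri_sign (signed_adj H) u' x1' y1' ->
  tri_sign (signed_adj G) u x2 y2 = tri_sign (signed_adj H) u' x2' y2' ->
  switching_equivalent G H.
Proof.
set a := signed_adj G; set b := signed_adj H.
move=> starG EG starH EH [fu fx1 fy1 fx2 fy2] t1 t2.
have asym x y : a x y = a y x by apply: signed_adj_sym.
have bsym x y : b x y = b y x by apply: signed_adj_sym.
have fE x y : (f x == f y) = (x == y) by rewrite (inj_eq perm_inj).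
have fnu x : x != u -> f x != u' by rewrite -fu fE.
have sqa x : x != u -> a u x * a u x = 1.
  by move=> /starG ux; rewrite -expr2 signed_adj_sqr ux.
have sqb x : x != u' -> b u' x * b u' x = 1.
  by move=> /starH ux; rewrite -expr2 signed_adj_sqr ux.
have triE x y : x != u -> y != u -> tri_sign b u' (f x) (f y) = tri_sign a u x y.
  move=> xu yu; rewrite (tri_sign_rim EG xu yu).
  rewrite (tri_sign_rim EH (fnu x xu) (fnu y yu)) -t1 -t2.
  by rewrite -fx1 -fx2 -fy1 -fy2 !fE.
pose Z := [set w | (w != u) && (a u w != b u' (f w))].
pose s w : int := if w \in Z then -1 else 1.
have sE w : w != u -> s w = a u w * b u' (f w).
  move=> wu; rewrite /s inE wu /=.
  have := sqb _ (fnu w wu); have := sqa w wu; rewrite -!expr2 => /eqP + /eqP.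
  by rewrite !sqrf_eq1 => /orP[] /eqP-> /orP[] /eqP->.
have bE x y : b (f x) (f y) = s x * s y * a x y.
  have su : s u = 1 by rewrite /s inE eqxx.
  have [->|xu] := eqVneq x u; have [->|yu] := eqVneq y u.
  - by rewrite fu /b /a !signed_adj_irr mulr0.
  - rewrite fu su mul1r sE // mulrAC sqa //; ring.
  - rewrite fu su mulr1 sE // bsym (asym x).
    by rewrite mulrAC sqa //; ring.
  have aE z w : z != u -> w != u -> a z w = a u z * a u w * tri_sign a u z w.
    move=> zu wu; rewrite /tri_sign (asym w u).
    transitivity ((a u z * a u z) * (a u w * a u w) * a z w); last by ring.
    by rewrite !sqa // !mul1r.
  have bE z w : z != u' -> w != u' -> b z w = b u' z * b u' w * tri_sign b u' z w.
    move=> zu wu; rewrite /tri_sign (bsym w u').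
    transitivity ((b u' z * b u' z) * (b u' w * b u' w) * b z w); last by ring.
    by rewrite !sqb // !mul1r.
  rewrite (bE (f x)) ?fnu // triE // (aE x) // !sE //.
  transitivity ((a u x * a u x) * (a u y * a u y)
    * (b u' (f x) * b u' (f y) * tri_sign a u x y)); last by ring.
  by rewrite !sqa // !mul1r.
have edgeE x y : ([set f x; f y] \in edges H) = ([set x; y] \in edges G).
  rewrite -!signed_adj_neq0 -/a -/b bE !mulf_eq0 !negb_or.
  by rewrite /s; case: ifP; case: ifP.
have im2 x y : f @: [set x; y] = [set f x; f y] by rewrite imsetU1 imset_set1.
exists Z, f; split.
  apply/setP => e; apply/idP/imsetP => [eH|[e' e'G ->]].
    have /eqP/cards2P[p [q [_ eE]]] := edges_card2 eH.
    exists [set f^-1%g p; f^-1%g q]; last by rewrite im2 !permKV.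
    by rewrite /= -edgeE !permKV -eE.
  have /eqP/cards2P[x [y [_ eE]]] := edges_card2 e'G.
  by rewrite eE im2 edgeE -eE.
move=> e eG; have eG' : e \in edges G by [].
have /eqP/cards2P[x [y [xy eE]]] := edges_card2 eG'.
have := bE x y; rewrite /b /a /signed_adj edgeE -eE eG' -im2 -eE => ->.
rewrite /= /switch_sigma eE.
have -> : #|[set x; y] :&: Z| = ((x \in Z) + (y \in Z))%N.
  rewrite setIUl cardsU.
  have -> : [set x] :&: Z :&: ([set y] :&: Z) = set0.
    apply/setP => z; rewrite !inE; apply/negbTE/negP.
    by move=> /andP[/andP[/eqP-> _] /andP[/eqP xy' _]]; rewrite xy' eqxx in xy.
  have one z : #|[set z] :&: Z| = (z \in Z).
    have [zZ|zZ] := boolP (z \in Z).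
      by rewrite (setIidPl _) ?sub1set // cards1.
    by apply/eqP; rewrite cards_eq0 setI_eq0 disjoints1.
  by rewrite cards0 subn0 !one.
by rewrite /s; case: (x \in Z); case: (y \in Z); rewrite /=; ring.
Qed.

Lemma cycle_sign3 n (G : sgraph n) u x y : uniq [:: u; x; y] ->
  [set u; x] \in edges G -> [set x; y] \in edges G -> [set y; u] \in edges G ->
  cycle_sign G [:: u; x; y] = tri_sign (signed_adj G) u x y.
Proof.
rewrite /= !inE negb_or andbT => /andP[/andP[ux uy] xy] e1 e2 e3.
rewrite /tri_sign /signed_adj e1 e2 e3 /cycle_sign !big_cons big_nil /=.
rewrite !eqxx (eq_sym x u) (negPf ux) (eq_sym y u) (negPf uy) (eq_sym y x).
by rewrite (negPf xy) mulr1 mulrA.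
Qed.

Lemma rim_edges n (G : sgraph n) u x1 y1 x2 y2 :
  [/\ x1 != u, y1 != u, x2 != u & y2 != u] ->
  (forall x y, x != u -> y != u -> ([set x; y] \in edges G) =
    ([set x; y] == [set x1; y1]) || ([set x; y] == [set x2; y2])) ->
  arcs (signed_adj G) (setT :\ u) = [set (x1, y1); (y1, x1); (x2, y2); (y2, x2)].
Proof.
move=> [x1u y1u x2u y2u] rimE; apply/setP => -[x y].
rewrite arcsE !in_setD1 !in_setT !andbT signed_adj_neq0 !inE !xpair_eqE.
have [->|xu] := eqVneq x u.
  by rewrite !(eq_sym u) (negPf x1u) (negPf y1u) (negPf x2u) (negPf y2u).
have [->|yu] := eqVneq y u.
  by rewrite !(eq_sym u) (negPf x1u) (negPf y1u) (negPf x2u) (negPf y2u) !andbF.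
by rewrite /= rimE // !set2_eq !orbA.
Qed.

Lemma pendant_edge n (u x y : 'I_n) (W : {set 'I_n}) : x != u -> y != u ->
  ([set x; y] \in [set [set u; w] | w in W]) = false.
Proof.
move=> xu yu; apply/negP => /imsetP[w _ /eqP]; rewrite set2_eq.
by rewrite (negPf xu) (negPf yu) andbF.
Qed.

Lemma Gamma1_star n (G : sgraph n) : is_Gamma1 G ->
  exists u x1 y1 x2 y2,
  [/\ forall x, x != u -> signed_adj G u x != 0,
      two_edges (signed_adj G) (setT :\ u) x1 y1 x2 y2, uniq [:: x1; y1; x2; y2],
      tri_sign (signed_adj G) u x1 y1 = 1 & tri_sign (signed_adj G) u x2 y2 = -1].
Proof.
move=> [u [a [b [c [d [un edgesE t1 t2]]]]]].
have := un; rewrite cons_uniq !inE !negb_or => /andP[/and4P[ua ub uc ud] un'].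
have rim : [/\ a != u, b != u, c != u & d != u] by rewrite !(eq_sym _ u).
have [au bu cu du] := rim.
have star x : x != u -> signed_adj G u x != 0.
  move=> xu; rewrite signed_adj_neq0 edgesE !inE !set2_eq eqxx /=.
  have [_|xa] := eqVneq x a; first by rewrite ?orbT.
  have [_|xb] := eqVneq x b; first by rewrite ?andbT ?orbT.
  have [_|xc] := eqVneq x c; first by rewrite ?orbT.
  have [_|xd] := eqVneq x d; first by rewrite ?andbT ?orbT.
  by apply/orP; right; apply/imsetP; exists x; rewrite // !inE !negb_or xu xa xb xc.
have edge x y : [set x; y] \in [set [set u; a]; [set a; b]; [set b; u];
    [set u; c]; [set c; d]; [set d; u]] -> [set x; y] \in edges G.
  by move=> e; rewrite edgesE inE e.
exists u, a, b, c, d; split => //.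
- split; last by left.
  apply: rim_edges => // x y xu yu.
  rewrite edgesE !inE pendant_edge // !set2_eq (negPf xu) (negPf yu).
  by rewrite !(andbF, orbF).
- rewrite -t1 cycle_sign3 //; try by apply: edge; rewrite !inE eqxx ?orbT.
  by move: un'; rewrite /= !inE !negb_or ua ub => /and3P[/and3P[-> _ _] _ _].
- rewrite -t2 cycle_sign3 //; try by apply: edge; rewrite !inE eqxx ?orbT.
  by move: un'; rewrite /= !inE !negb_or uc ud => /and4P[_ _ -> _].
Qed.

Lemma Gamma2_star n (G : sgraph n) : is_Gamma2 G ->
  exists u x y1 y2,
  [/\ forall x, x != u -> signed_adj G u x != 0,
      two_edges (signed_adj G) (setT :\ u) x y1 x y2, uniq [:: x; y1; y2],
      tri_sign (signed_adj G) u x y1 = 1 & tri_sign (signed_adj G) u x y2 = -1].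
Proof.
move=> [u [v [a [b [un edgesE t1 t2]]]]].
have := un; rewrite cons_uniq !inE !negb_or => /andP[/and3P[uv ua ub] un'].
have [vu au bu] : [/\ v != u, a != u & b != u] by rewrite !(eq_sym _ u).
have star x : x != u -> signed_adj G u x != 0.
  move=> xu; rewrite signed_adj_neq0 edgesE !inE !set2_eq eqxx /=.
  have [_|xv] := eqVneq x v; first by rewrite ?orbT.
  have [_|xa] := eqVneq x a; first by rewrite ?andbT ?orbT.
  have [_|xb] := eqVneq x b; first by rewrite ?andbT ?orbT.
  by apply/orP; right; apply/imsetP; exists x; rewrite // !inE !negb_or xu xv xa.
have edge x y : [set x; y] \in [set [set u; v]; [set v; a]; [set a; u];
    [set v; b]; [set b; u]] -> [set x; y] \in edges G.
  by move=> e; rewrite edgesE inE e.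
exists u, v, a, b; split => //.
- split; last by right.
  apply: rim_edges => // x y xu yu.
  rewrite edgesE !inE pendant_edge // !set2_eq (negPf xu) (negPf yu).
  by rewrite !(andbF, orbF).
- rewrite -t1 cycle_sign3 //; try by apply: edge; rewrite !inE eqxx ?orbT.
  by move: un'; rewrite /= !inE !negb_or uv ua => /andP[/andP[-> _] _].
- rewrite -t2 cycle_sign3 //; try by apply: edge; rewrite !inE eqxx ?orbT.
  by move: un'; rewrite /= !inE !negb_or uv ub => /andP[/andP[_ ->] _].
Qed.

(** Since [tri] vanishes, the two triangles at [u] have opposite signs; they are interchanged if the
    first is negative. Disjoint outer edges lead to [G1], edges with a common endpoint to [G2]. *)
Lemma full_vertex_switching n (G G1 G2 : sgraph n) u :
  is_Gamma1 G1 -> is_Gamma2 G2 -> #|edges G| = n.+1 ->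
  tri (signed_adj G) setT = 0 -> (deg (signed_adj G) setT u).+1 = n ->
  switching_equivalent G G1 \/ switching_equivalent G G2.
Proof.
move=> /Gamma1_star[u1 [a1 [b1 [c1 [d1 [star1 E1 un1 s1 t1]]]]]].
move=> /Gamma2_star[u2 [v2 [a2 [b2 [star2 E2 un2 s2 t2]]]]] eG tri0 degu.
have asym := @signed_adj_sym n G; have airr := @signed_adj_irr n G.
have asqr := @signed_adj_sqr n G.
have uT : u \in [set: 'I_n] by [].
have star := full_deg airr uT.
have {}star x : x != u -> signed_adj G u x != 0.
  by move=> xu; apply: star; rewrite // cardsT card_ord.
have sumT : (\sum_(x in [set: 'I_n]) deg (signed_adj G) setT x
    = 2 * #|[set: 'I_n]|.+1)%N by rewrite sum_signed_deg eG cardsT card_ord.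
have sumR := sum_deg_rim asym airr asqr uT (fun x _ => @star x) sumT.
have [x1 [y1 [x2 [y2 E]]]] := two_edgesP asym airr sumR.
have sq x : x != u -> signed_adj G u x ^+ 2 = 1 by move=> /star ux; rewrite asqr ux.
have tri1 x y : x != u -> y != u -> signed_adj G x y != 0 ->
    tri_sign (signed_adj G) u x y = 1 \/ tri_sign (signed_adj G) u x y = -1.
  move=> xu yu xy; apply/pred2P; rewrite /= -sqrf_eq1 /tri_sign !exprMn.
  by rewrite (asym y) !sq // asqr xy.
have [x1R y1R x2R y2R] := two_edges_mem E.
have [x1u y1u x2u y2u] : [/\ x1 != u, y1 != u, x2 != u & y2 != u].
  by move: x1R y1R x2R y2R; rewrite !in_setD1 !in_setT !andbT.
have tri2 : tri_sign (signed_adj G) u x2 y2 = - tri_sign (signed_adj G) u x1 y1.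
  by move: tri0; rewrite (tri_star_setT E); lia.
have xy1 : signed_adj G x1 y1 != 0.
  by rewrite -(mem_arcs _ x1R y1R); case: (E) => -> _; rewrite !inE eqxx.
have swapE : two_edges (signed_adj G) (setT :\ u) x2 y2 x1 y1.
  case: (E) => EE hu; split.
    by rewrite EE -[LHS]setUA setUC !setUA.
  case: hu => [un|[x21 un]].
    by left; rewrite -(uniq_catC [:: x1; y1] [:: x2; y2]).
  right; split=> //; move: un; rewrite x21 /= !inE !negb_or !andbT.
  by rewrite (eq_sym y2) => /andP[/andP[-> ->] ->].
have mapping (H : sgraph n) u' p q r s p' q' r' s' :
    (forall x, x != u' -> signed_adj H u' x != 0) ->
    two_edges (signed_adj G) (setT :\ u) p q r s ->
    two_edges (signed_adj H) (setT :\ u') p' q' r' s' ->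
    uniq [:: p; q; r; s] && uniq [:: p'; q'; r'; s']
    || [&& r == p, r' == p', uniq [:: p; q; s] & uniq [:: p'; q'; s']] ->
    tri_sign (signed_adj G) u p q = tri_sign (signed_adj H) u' p' q' ->
    tri_sign (signed_adj G) u r s = tri_sign (signed_adj H) u' r' s' ->
    switching_equivalent G H.
  move=> starH EG EH hun e1 e2.
  have notu (K : sgraph n) w z1 z2 z3 z4 :
      two_edges (signed_adj K) (setT :\ w) z1 z2 z3 z4 ->
      w \notin [:: z1; z2; z3; z4].
    move=> /two_edges_mem[]; rewrite !in_setD1 !in_setT !andbT => h1 h2 h3 h4.
    by rewrite !inE !negb_or !(eq_sym w) h1 h2 h3 h4.
  have [f fE] : exists f : {perm 'I_n},
      [:: f u; f p; f q; f r; f s] = [:: u'; p'; q'; r'; s'].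
    case/orP: hun => [/andP[un un']|/and4P[/eqP rp /eqP rp' un un']].
      apply: (@perm_extending _ [:: u; p; q; r; s] [:: u'; p'; q'; r'; s']) => //.
        by rewrite cons_uniq un (notu _ _ _ _ _ _ EG).
      by rewrite cons_uniq un' (notu _ _ _ _ _ _ EH).
    have [|||f [fu fp fq fs]] := @perm_extending _ [:: u; p; q; s] [:: u'; p'; q'; s'].
    - rewrite cons_uniq un andbT; have := notu _ _ _ _ _ _ EG.
      by rewrite !inE !negb_or => /and4P[-> -> _ ->].
    - rewrite cons_uniq un' andbT; have := notu _ _ _ _ _ _ EH.
      by rewrite !inE !negb_or => /and4P[-> -> _ ->].
    - by [].
    by exists f; rewrite rp rp' fu fp fq fs.
  exact: (star_switching_equivalent _ EG starH EH fE).
case: (E) => _ [un|[x21 un]].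
  left; have [t|t] := tri1 _ _ x1u y1u xy1.
    by apply: (mapping G1 _ _ _ _ _ _ _ _ _ star1 E E1);
       rewrite ?un ?un1 ?tri2 ?t ?s1 ?t1.
  apply: (mapping G1 _ _ _ _ _ _ _ _ _ star1 swapE E1);
    rewrite ?un1 ?tri2 ?t ?s1 ?t1 //.
  by rewrite -(uniq_catC [:: x1; y1] [:: x2; y2]) un.
right; have [t|t] := tri1 _ _ x1u y1u xy1.
  by apply: (mapping G2 _ _ _ _ _ _ _ _ _ star2 E E2);
     rewrite ?un ?un2 ?tri2 ?t ?s2 ?t2 ?x21 ?eqxx ?orbT.
apply: (mapping G2 _ _ _ _ _ _ _ _ _ star2 swapE E2); rewrite ?tri2 ?t ?s2 ?t2 //.
rewrite un2 x21 !eqxx /=; move: un; rewrite /= !inE !negb_or !andbT (eq_sym y2 y1).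
by move=> /andP[/andP[-> ->] ->]; rewrite orbT.
Qed.

(** * Numerical estimates *)

Section Estimates.
Variable R : realType.
Implicit Types N b : R.

Lemma cosh_tail_sqrt_lt (x y : R) : 0 <= x < y ->
  cosh_tail (Num.sqrt x) < cosh_tail (Num.sqrt y).
Proof.
move=> /andP[x0 xy]; apply: cosh_tail_lt.
by rewrite sqrtr_ge0 ltr_sqrt ?(le_lt_trans x0).
Qed.

Lemma sqrt_sqrt_pow4 (x : R) : 0 <= x -> Num.sqrt (Num.sqrt x) ^+ 4 = x.
Proof. by move=> x0; rewrite -[4%N]/(2 * 2)%N exprM !sqr_sqrtr ?sqrtr_ge0. Qed.

Lemma lt_sqr (x y : R) : 0 <= y -> x ^+ 2 < y ^+ 2 -> x < y.
Proof.
move=> y0; rewrite !ltNge; apply: contra => yx.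
by rewrite lerXn2r ?nnegrE // (le_trans y0).
Qed.

(* The eigenvalues of Gamma_1 other than 0, 1 and -1 are square roots of the
   roots of t^2 - n t + n - 5; this is the larger root. *)
Definition Gamma1_root N := (N + Num.sqrt (N ^+ 2 - 4 * N + 20)) / 2.

Lemma Gamma1_rootE N : 5 <= N ->
  Gamma1_root N ^+ 2 - N * Gamma1_root N + (N - 5) = 0.
Proof.
move=> N5; have D0 : 0 <= N ^+ 2 - 4 * N + 20 by nra.
by have := sqr_sqrtr D0; rewrite /Gamma1_root; set s := Num.sqrt _ => sE; nra.
Qed.

(** Let q be the left side and t the root. As t >= N / 2, the quadratic increases beyond t, so t <=
    q would give N q <= N^2 - N + 4. But (N q)^2 exceeds the square of the right side by 8 N -
    16. *)
Lemma Gamma1_root_gt N : 5 <= N ->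
  Num.sqrt (N ^+ 2 - 2 * N + 9) < Gamma1_root N.
Proof.
move=> N5; have tE := Gamma1_rootE N5.
have tN : N <= 2 * Gamma1_root N.
  by have := sqrtr_ge0 (N ^+ 2 - 4 * N + 20); rewrite /Gamma1_root; lra.
have q0 := sqrtr_ge0 (N ^+ 2 - 2 * N + 9).
have D0 : 0 <= N ^+ 2 - 2 * N + 9 by nra.
have qE := sqr_sqrtr D0; move: q0 qE tE tN.
move: (Num.sqrt _) (Gamma1_root N) => q t q0 qE tE tN.
rewrite ltNge; apply/negP => tq.
have h1 : N * q <= N ^+ 2 - N + 4.
  have : 0 <= (q - t) * (q + t - N) by rewrite mulr_ge0 //; lra.
  by nra.
have h2 : (N * q) ^+ 2 <= (N ^+ 2 - N + 4) ^+ 2.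
  by rewrite lerXn2r // nnegrE ?mulr_ge0 //; nra.
move: h2; rewrite exprMn qE; nra.
Qed.

(* The nonzero eigenvalues of Gamma_2 are the square roots of the two roots of
   t^2 - (n + 1) t + 2 n - 4, selected by e = 1 and e = -1. *)
Definition Gamma2_root N (e : R) :=
  (N + 1 + e * Num.sqrt (N ^+ 2 - 6 * N + 17)) / 2.

Lemma Gamma2_rootE N (e : R) : 5 <= N -> e ^+ 2 = 1 ->
  Gamma2_root N e ^+ 2 - (N + 1) * Gamma2_root N e + (2 * N - 4) = 0.
Proof.
move=> N5 e1; have D0 : 0 <= N ^+ 2 - 6 * N + 17 by nra.
have := sqr_sqrtr D0; rewrite /Gamma2_root; set s := Num.sqrt _ => sE.
have : e ^+ 2 * s ^+ 2 = N ^+ 2 - 6 * N + 17 by rewrite e1 mul1r.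
by nra.
Qed.

Lemma Gamma2_root_gt0 N (e : R) : 5 <= N -> e = 1 \/ e = -1 -> 0 < Gamma2_root N e.
Proof.
move=> N5 e1; have D0 : 0 <= N ^+ 2 - 6 * N + 17 by nra.
have := sqr_sqrtr D0; have := sqrtr_ge0 (N ^+ 2 - 6 * N + 17).
rewrite /Gamma2_root; set s := Num.sqrt _ => s0 sE.
have : s < N + 1 by nra.
by case: e1 => ->; lra.
Qed.

(** By the quadratic equation the claim amounts to (N - 1)^2 < (N + 1) s, where s is the square root
    in the formula; the squares of the two sides differ by 32 N + 16. *)
Lemma Gamma2_root_sqr N : 5 <= N -> N ^+ 2 - 2 * N + 5 < Gamma2_root N 1 ^+ 2.
Proof.
move=> N5; have D0 : 0 <= N ^+ 2 - 6 * N + 17 by nra.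
have tE := @Gamma2_rootE N 1 N5 (expr1n _ _).
have : N ^+ 2 + 1 < (N + 1) * Gamma2_root N 1; last by lra.
have := sqr_sqrtr D0; have := sqrtr_ge0 (N ^+ 2 - 6 * N + 17).
rewrite /Gamma2_root; set s := Num.sqrt _ => s0 sE.
have : (N - 1) ^+ 2 < (N + 1) * s; last by nra.
have e0 : 0 <= (N + 1) * s by rewrite mulr_ge0 //; lra.
have : ((N - 1) ^+ 2) ^+ 2 < ((N + 1) * s) ^+ 2 by rewrite [ltRHS]exprMn sE; nra.
by rewrite ltr_pXn2r // nnegrE sqr_ge0.
Qed.

Lemma Gamma2_root5 : 22 < Gamma2_root 5 1 ^+ 2.
Proof.
have D0 : 0 <= (5 ^+ 2 - 6 * 5 + 17 : R) by lra.
have := sqr_sqrtr D0; have := sqrtr_ge0 (5 ^+ 2 - 6 * 5 + 17 : R).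
rewrite /Gamma2_root; set s := Num.sqrt _ => s0 sE.
have : 69 / 20 < s by apply: lt_sqr => //; lra.
by nra.
Qed.

(** From e^(-b/4) >= 1 - b/4 >= 2/5 it follows that e^b <= (5/2)^4 < 40. *)
Lemma expR_le40 (b : R) : b <= 12 / 5 -> expR b <= 40.
Proof.
move=> b12; have h : 2 / 5 <= expR (- (b / 4)).
  by apply: le_trans (expR_ge1Dx _); lra.
have h4 : (2 / 5) ^+ 4 <= expR (- b).
  rewrite (_ : - b = 4%:R * - (b / 4)); last by field.
  by rewrite expRM_natl lerXn2r // nnegrE ?expR_ge0 //; lra.
have := ler_wpM2l (expR_ge0 b) h4; rewrite expRxMexpNx_1; lra.
Qed.

(** If b exceeds a at all, it does so by at most 1/400. The tangent of exp at b then bounds psi(b) -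
    psi(a) by e^b (b - a) <= 1/10, whereas psi(c) >= c^4 / 12 >= 4/25. *)
Lemma cosh_tail_gap (a b c : R) : 0 <= a -> 0 <= b ->
  139 / 25 < a ^+ 2 -> b ^+ 2 < 39 / 7 -> 7 / 5 < c ^+ 2 ->
  cosh_tail b < cosh_tail a + cosh_tail c.
Proof.
move=> a0 b0 a2 b2 c2.
have ctail : 4 / 25 <= cosh_tail c.
  have c4 : (7 / 5) ^+ 2 <= (c ^+ 2) ^+ 2.
    by rewrite lerXn2r ?nnegrE ?sqr_ge0 ?ltW //; lra.
  by apply: le_trans (cosh_tail_ge c); rewrite (exprM c 2 2); move: c4; clear; lra.
have [ba|ab] := ltP b a.
  have : cosh_tail b < cosh_tail a by apply: cosh_tail_lt; rewrite b0.
  by move: ctail; clear; lra.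
have alo : 7 / 3 < a by apply: lt_sqr => //; move: a2; clear; lra.
have bhi : b <= 12 / 5 by apply/ltW/lt_sqr; [clear; lra | move: b2; clear; lra].
have bma : b - a <= 1 / 400.
  have ab0 : 0 <= b - a by rewrite subr_ge0.
  have ab14 : 14 / 3 <= b + a by move: alo ab; clear; lra.
  have : (b - a) * (b + a) = b ^+ 2 - a ^+ 2 by ring.
  by move: (ler_wpM2l ab0 ab14) a2 b2; clear; lra.
have eba : expR b * (b - a) <= 1 / 10.
  rewrite (_ : 1 / 10 = 40 * (1 / 400)); last by field.
  by rewrite ler_pM ?expR_ge0 ?subr_ge0 ?expR_le40.
have ea : expR b - expR b * (b - a) <= expR a.
  have -> : expR a = expR b * expR (a - b) by rewrite -expRD; congr expR; ring.
  rewrite (_ : expR b - _ = expR b * (1 + (a - b))); last by ring.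
  by rewrite ler_wpM2l ?expR_ge0 // expR_ge1Dx.
have en : expR (- b) <= expR (- a) by rewrite ler_expR lerN2.
have ab2 : a ^+ 2 <= b ^+ 2 by rewrite lerXn2r ?nnegrE.
have -> : cosh_tail b = cosh_tail a + (expR b - expR a)
    + (expR (- b) - expR (- a)) - (b ^+ 2 - a ^+ 2).
  by rewrite /cosh_tail; ring.
by move: ctail eba ea en ab2; clear; lra.
Qed.

(* For n = 6 the fourth moment only gives T^4 <= 31, slightly above the
   square of the larger root, and the smaller root has to be used as well. *)
Lemma Gamma2_root6 : cosh_tail (Num.sqrt (Num.sqrt 31)) <
  cosh_tail (Num.sqrt (Gamma2_root 6 1))
    + cosh_tail (Num.sqrt (Gamma2_root 6 (-1))) :> R.
Proof.
have D0 : 0 <= (6 ^+ 2 - 6 * 6 + 17 : R) by lra.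
have := sqr_sqrtr D0; have := sqrtr_ge0 (6 ^+ 2 - 6 * 6 + 17 : R).
rewrite /Gamma2_root; move: (Num.sqrt _) => s s0 sE.
(* Bounds on the square root of 17: they give 139/25 for the larger root and 7/5 for the smaller
   one. The constant 39/7 comes from 31 < (39/7)^2. *)
have slo : 103 / 25 < s by apply: lt_sqr => //; lra.
have shi : s < 21 / 5 by apply: lt_sqr; lra.
apply: cosh_tail_gap; rewrite ?sqrtr_ge0 //.
- by rewrite sqr_sqrtr; lra.
- rewrite sqr_sqrtr ?sqrtr_ge0 //; apply: lt_sqr; first by lra.
  by rewrite sqr_sqrtr; lra.
- by rewrite sqr_sqrtr; lra.
Qed.

End Estimates.

(** * Comparison of the Estrada indices *)

Section Comparison.
Variables (R : realType) (n : nat) (n_ge5 : (5 <= n)%N).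
Implicit Types G : sgraph n.
Let N : R := n%:R.

Let N_ge5 : 5 <= N.
Proof. by rewrite /N (ler_nat R 5 n). Qed.

Lemma estrada_Gamma1_lower G : is_Gamma1 G ->
  N + n.+1%:R + cosh_tail (Num.sqrt (Gamma1_root N)) <= estrada R G.
Proof.
move=> /Gamma1_star[u [x1 [y1 [x2 [y2 [star E un t1 t2]]]]]].
have tri0 : tri (signed_adj G) setT = 0 by rewrite (tri_star_setT E) t1 t2.
have t_gt1 : 1 < Gamma1_root N.
  by have := sqrtr_ge0 (N ^+ 2 - 4 * N + 20); rewrite /Gamma1_root; move: N_ge5; lra.
set mu := Num.sqrt _; have mu2 : mu ^+ 2 = Gamma1_root N.
  by rewrite sqr_sqrtr // ltW // (lt_trans ltr01).
have mu0 : 0 < mu by rewrite sqrtr_gt0 (lt_trans ltr01).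
have mu1 : mu != 1 by apply: contraTneq t_gt1 => e; rewrite -mu2 e expr1n ltxx.
rewrite -(card_edges_star star E) -cubic_tailD.
have -> : cubic_tail mu + cubic_tail (- mu) = \sum_(x <- [:: mu; - mu]) cubic_tail x.
  by rewrite !big_cons big_nil addr0.
apply: estrada_lower => //.
  by rewrite /= inE eq_sym eqNr gt_eqF.
have eig nu : nu ^+ 2 = Gamma1_root N -> nu != 0 -> nu != -1 ->
    eigenvalue (adjmx R G) nu.
  move=> nu2 nu0 nu1.
  by apply: (disjoint_star_eigenvalue star E) => //=; rewrite nu2 Gamma1_rootE.
move=> nu; rewrite !inE => /orP[] /eqP->.
  by apply: eig; rewrite ?gt_eqF //; move: mu0; lra.
by apply: eig; rewrite ?sqrrN ?eqr_opp // oppr_eq0 gt_eqF.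
Qed.

(** Both pairs of nonzero eigenvalues are kept because n = 6 needs them; in the other cases the
    smaller pair is dropped by [cosh_tail_ge0]. *)
Lemma estrada_Gamma2_lower G : is_Gamma2 G ->
  N + n.+1%:R + cosh_tail (Num.sqrt (Gamma2_root N 1))
    + cosh_tail (Num.sqrt (Gamma2_root N (-1))) <= estrada R G.
Proof.
move=> /Gamma2_star[u [x [y1 [y2 [star E un t1 t2]]]]].
have tri0 : tri (signed_adj G) setT = 0 by rewrite (tri_star_setT E) t1 t2.
have s1_gt0 := @Gamma2_root_gt0 R N 1 N_ge5 (or_introl erefl).
have s2_gt0 := @Gamma2_root_gt0 R N (-1) N_ge5 (or_intror erefl).
have s12 : Gamma2_root N (-1) < Gamma2_root N 1.
  have : 0 < Num.sqrt (N ^+ 2 - 6 * N + 17) by rewrite sqrtr_gt0; move: N_ge5; nra.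
  by rewrite /Gamma2_root; lra.
have eig nu e : e ^+ 2 = 1 -> nu ^+ 2 = Gamma2_root N e -> 0 < Gamma2_root N e ->
    eigenvalue (adjmx R G) nu.
  move=> e1 nu2 pos; apply: (shared_star_eigenvalue star E t1 t2) => //=.
    by rewrite nu2 Gamma2_rootE.
  by apply: contraTneq pos => nu0; rewrite -nu2 nu0 expr0n ltxx.
have root_gt0 (r : R) : 0 < r -> 0 < Num.sqrt r by rewrite sqrtr_gt0.
have b_gt0 := root_gt0 _ s2_gt0; have := s12; rewrite -(ltr_sqrt _ s1_gt0).
have a2 := sqr_sqrtr (ltW s1_gt0); have b2 := sqr_sqrtr (ltW s2_gt0).
move: a2 b2 b_gt0; set a := Num.sqrt _; set b := Num.sqrt _ => a2 b2 b_gt0 ba.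
rewrite -(card_edges_star star E) -!cubic_tailD.
apply: (le_trans _ (@estrada_lower R n G [:: a; - a; b; - b] tri0 _ _)).
- by rewrite !big_cons big_nil addr0 -!addrA.
- have ne (p q : R) : q < p -> (p != q) * (q != p).
    by move=> qp; rewrite gt_eqF // lt_eqF.
  have [h1 h2 h3] : [/\ - a < a, - b < a & - a < b].
    by clear - b_gt0 ba; split; lra.
  have [h4 h5] : - a < - b /\ - b < b by clear - b_gt0 ba; split; lra.
  by rewrite /= !inE !negb_or !(ne _ _ h1, ne _ _ h2, ne _ _ h3, ne _ _ h4,
    ne _ _ h5, ne _ _ ba).
- move=> nu; rewrite !inE => /or4P[] /eqP->.
  + by apply: (eig _ 1); rewrite ?expr1n.
  + by apply: (eig _ 1); rewrite ?sqrrN ?expr1n.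
  + by apply: (eig _ (-1)); rewrite ?sqrrN ?expr1n.
  + by apply: (eig _ (-1)); rewrite ?sqrrN ?expr1n.
Qed.

(** The weight 2 (n^2 - n + 10) less 2 (n + 1) is twice n^2 - 2n + 9. The symmetry of the spectrum
    comes from [shared_star_skew]. *)
Lemma estrada_Gamma2_upper G : is_Gamma2 G ->
  estrada R G
    <= N + n.+1%:R + cosh_tail (Num.sqrt (Num.sqrt (N ^+ 2 - 2 * N + 9))).
Proof.
move=> /Gamma2_star[u [x [y1 [y2 [star E un t1 t2]]]]].
have tri0 : tri (signed_adj G) setT = 0 by rewrite (tri_star_setT E) t1 t2.
have eG := card_edges_star star E.
have [weightE _] := star_weight_shared (@signed_adj_sym n G) (@signed_adj_irr n G)
  (@signed_adj_sqr n G) (in_setT u) (fun x _ => @star x) E erefl un tri0.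
have [rs [cp permrs size_rs [_ s2 _ s4]]] := signed_spectrum R G.
rewrite -eG; apply: (estrada_le permrs size_rs s2).
- exact: (skew_symmetric cp (shared_star_skew star E R t1 t2 erefl un)).
- by rewrite eG.
- exact: sqrtr_ge0.
rewrite sqrt_sqrt_pow4; last by move: N_ge5; nra.
rewrite s4 weightE eG cardsT card_ord /N; case: n n_ge5 => // m _ /=.
rewrite le_eqVlt; apply/orP; left; apply/eqP.
rewrite rmorphM /= -!pmulrn !natrD natrX natrM -[m.+2]addn2 -[m.+1]addn1 !natrD; ring.
Qed.

Lemma fourth_moment_other G : bicyclic G -> unbalanced G ->
  tri (signed_adj G) setT = 0 ->
  (forall u, (deg (signed_adj G) setT u).+1 != n) ->
  weight (signed_adj G) setT
    <= 2 * (n ^ 2 - n + 6)%N%:Z + (if (n <= 6)%N then 4 else 0).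
Proof.
move=> [conG eG] unb tri0 Delta; set a := signed_adj G.
have quad8 X : quad a X <= 8.
  apply: (quad_le8 (@signed_adj_sym n G) (@signed_adj_irr n G) (@signed_adj_sqr n G)).
    exact: unbalanced_no_potential.
  by rewrite card_signed_arcs eG card_ord.
have cV : #|[set: 'I_n]| = n by rewrite cardsT card_ord.
have := @weight_bound _ a (@signed_adj_sym n G) (@signed_adj_irr n G)
  (@signed_adj_sqr n G) setT quad8.
rewrite cV; apply => //.
- exact: connected_cut.
- by rewrite sum_signed_deg eG.
move=> x _; have lt := deg_lt (@signed_adj_irr n G) (in_setT x).
by rewrite cV leq_eqVlt (negPf (Delta x)) in lt.
Qed.

End Comparison.

Theorem theorem3p7 (R : realType) (n : nat) (n_ge5 : (5 <= n)%N)
    (G1 G2 G : sgraph n) (G1P : is_Gamma1 G1) (G2P : is_Gamma2 G2)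
    (G_unbalanced : unbalanced G) (G_bicyclic : bicyclic G)
    (G_pairing : pairing R G)
    (G_neq1 : ~ isomorphic G G1) (G_neq2 : ~ isomorphic G G2)
    (G_nsw1 : ~ switching_equivalent G G1)
    (G_nsw2 : ~ switching_equivalent G G2) :
  estrada R G1 > estrada R G2 /\ estrada R G2 > estrada R G.
Proof.
pose N : R := n%:R.
have N5 : 5 <= N by rewrite (ler_nat R 5 n).
split.
  apply: le_lt_trans (estrada_Gamma2_upper R n_ge5 G2P) _.
  apply: lt_le_trans (estrada_Gamma1_lower R n_ge5 G1P).
  by rewrite ltrD2l cosh_tail_sqrt_lt // sqrtr_ge0 Gamma1_root_gt.
have eG : #|edges G| = n.+1 by case: G_bicyclic.
have [rs [cp permrs size_rs [_ s2 s3 s4]]] := signed_spectrum R G.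
have sym : perm_eq rs (map -%R rs).
  apply: (pairing_symmetric _ G_pairing).
  by rewrite -[adjmx R G]scale1r cp; apply: eq_bigr => r _; rewrite mul1r.
have tri0 : tri (signed_adj G) setT = 0.
  apply/eqP; rewrite -(intr_eq0 R) -s3; apply/eqP.
  have : \sum_(r <- rs) r ^+ 3 = - \sum_(r <- rs) r ^+ 3; last by lra.
  rewrite [LHS](perm_big _ sym) big_map -sumrN; apply: eq_bigr => r _.
  by rewrite exprNn -signr_odd expr1 mulN1r.
have Delta u : (deg (signed_adj G) setT u).+1 != n.
  by apply/eqP => du; case: (full_vertex_switching G1P G2P eG tri0 du).
have wG := fourth_moment_other n_ge5 G_bicyclic G_unbalanced tri0 Delta.
have upper (B : R) : 0 <= B -> \sum_(r <- rs) r ^+ 4 <= 2 * B ->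
    estrada R G <= N + n.+1%:R + cosh_tail (Num.sqrt (Num.sqrt B)).
  move=> B0 s4B; rewrite -eG; apply: (estrada_le permrs size_rs s2 sym).
  - by rewrite eG.
  - exact: sqrtr_ge0.
  - by rewrite sqrt_sqrt_pow4.
have lower := estrada_Gamma2_lower R n_ge5 G2P.
have tail2 := cosh_tail_ge0 (Num.sqrt (Gamma2_root N (-1))).
have conclude (B : R) : 0 <= B -> \sum_(r <- rs) r ^+ 4 <= 2 * B ->
    B < Gamma2_root N 1 ^+ 2 -> estrada R G < estrada R G2.
  move=> B0 s4B B_lt; apply: le_lt_trans (upper B B0 s4B) _.
  apply: lt_le_trans lower; rewrite -[ltRHS]addrA ltrD2l; apply: ltr_wpDr => //.
  apply: cosh_tail_sqrt_lt; rewrite sqrtr_ge0.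
  apply: lt_sqr; first by apply/ltW/Gamma2_root_gt0 => //; left.
  by rewrite sqr_sqrtr.
have s4le (c : int) : weight (signed_adj G) setT <= 2 * c ->
    \sum_(r <- rs) r ^+ 4 <= 2 * (c%:~R - n.+1%:R).
  by move=> wc; rewrite s4 eG mulrBr natrM lerD2r -[2]/(2%:~R) -intrM ler_int.
have [n7|n6] := leqP 7 n.
  (* Half the weight bound, n^2 - n + 6, less the n + 1 edges. *)
  apply: (conclude (N ^+ 2 - 2 * N + 5)); last exact: Gamma2_root_sqr.
    by move: N5; nra.
  have := s4le (n ^ 2 - n + 6)%N%:Z; rewrite leqNgt n7 addr0 in wG.
  move=> /(_ wG); rewrite -pmulrn natrD natrB ?natrX; last by nia.
  by rewrite -[n.+1]addn1 natrD -/N; lra.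
have n1E : n.+1%:R = N + 1 by rewrite -addn1 natrD.
have [n5|n6'] : n = 5%N \/ n = 6%N by lia.
  (* For n = 5 half the weight is at most 26 + 2 = 28; subtracting the 6 edges leaves 22. *)
  have w28 : weight (signed_adj G) setT <= 2 * 28.
    by move: wG; move: (weight _ _) => w; rewrite n5.
  have NE : N = 5 by rewrite /N n5.
  have := s4le 28 w28; rewrite n1E NE => le.
  apply: (conclude 22); [by lra | by move: le; clear; lra |].
  by rewrite NE; exact: Gamma2_root5.
(* For n = 6 half the weight is at most 36 + 2 = 38; subtracting the 7 edges leaves 31, too large
   for [conclude]. *)
have w38 : weight (signed_adj G) setT <= 2 * 38.
  by move: wG; move: (weight _ _) => w; rewrite n6'.
have NE : N = 6 by rewrite /N n6'.
have := s4le 38 w38; rewrite n1E NE => le.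
apply: le_lt_trans (upper 31 _ _) _; [by lra | by move: le; clear; lra |].
apply: lt_le_trans lower; rewrite -[ltRHS]addrA ltrD2l -/N NE.
exact: Gamma2_root6.
Qed.
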